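(* Let $\{\mathbf e_j\}_{j=1}^\infty$ be a normalized quasi-greedy basis in a (real or complex) Banach space $\mathbb X$. Then $$C_N\approx \max\{\mu(N),k_N\},\qquad \forall\,N=1,2,\ldots,$$ that is, there exist constants $c,c'>0$, independent of $N$, such that $c\,\max\{\mu(N),k_N\}\le C_N\le c'\max\{\mu(N),k_N\}$ for all integers $N\ge 1$.
   Context: $\mathbb X$ is a real or complex Banach space with norm $\|\cdot\|$, and $\{\mathbf e_j\}_{j=1}^\infty$ is a countable (Schauder) basis, normalized: $\|\mathbf e_j\|=1$ for all $j$. Each $x\in\mathbb X$ has a unique expansion $x=\sum_{j=1}^\infty a_j(x)\mathbf e_j$. Greedy algorithm: a greedy ordering for $x$ is an injective map $\pi:\mathbb N\to\mathbb N$ whose range contains $\{j: a_j(x)\ne0\}$ and such that $|a_{\pi(k)}(x)|\ge|a_{\pi(k+1)}(x)|$ for all $k\in\mathbb N$. Given such $\pi$, $G_N(x)=G_N^\pi(x)=\sum_{k=1}^N a_{\pi(k)}(x)\mathbf e_{\pi(k)}$. The basis is quasi-greedy if $G_N(x)\to x$ as $N\to\infty$ for all $x\in\mathbb X$; this is known to be equivalent to the existence of a constant $\widetilde K$ such that $\|G_N^\pi(x)\|\le \widetilde K\|x\|$ for all $x\in\mathbb X$, all $N\ge 1$ and all greedy orderings $\pi$ for $x$. $\Sigma_N$ is the set of all $y\in\mathbb X$ with at most $N$ nonzero coefficients in the basis expansion, and $\sigma_N(x)=\inf_{y\in\Sigma_N}\|x-y\|$. $C_N=\sup_{x\in\mathbb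 X}\dfrac{\|x-G_N(x)\|}{\sigma_N(x)}$, the supremum being over all $x$ with $\sigma_N(x)\neq0$ and all greedy orderings for $x$ (if $\sigma_N(x)=0$ then $x\in\Sigma_N$ and $G_N(x)=x$). $h_l(n)=\inf_{|A|=n}\|\sum_{j\in A}\mathbf e_j\|$, $h_r(n)=\sup_{|A|=n}\|\sum_{j\in A}\mathbf e_j\|$ (over $A\subset\mathbb N$), and $\mu(N)=\sup_{1\le n\le N} h_r(n)/h_l(n)$. For finite $A\subset\mathbb N$, $S_A(x)=\sum_{j\in A}a_j(x)\mathbf e_j$, and $k_N=\sup_{|A|\le N}\|S_A\|$ (operator norm). *)

(* Defs.v *)
From HB Require Import structures.
From mathcomp Require Import all_boot all_order all_algebra.
From mathcomp Require Import finmap.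
From mathcomp Require Import all_classical all_reals all_analysis.
From mathcomp Require Import complex.

Set Implicit Arguments.
Unset Strict Implicit.
Unset Printing Implicit Defensive.

Import Order.TTheory GRing.Theory Num.Theory.
Import numFieldNormedType.Exports.

Local Open Scope classical_set_scope.
Local Open Scope card_scope.
Local Open Scope ring_scope.

(* The basis e_1, e_2, ... is indexed from 0 throughout. *)

Section basis.
Context (K : numFieldType) (X : completeNormedModType K).
Implicit Types (e : nat -> X) (a : nat -> K) (x : X) (pi : nat -> nat).

Definition expansion e x a := series (fun j => a j *: e j) @ \oo --> x.

Definition schauder_basis e := forall x, exists! a, expansion e x a.

Definition normalized e := forall j, `|e j| = 1.

(* The default value 0 of xget is irrelevant when e is a Schauder basis. *)
Definition coef e x : nat -> K := xget (fun=> 0) [set a | expansion e x a].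

Definition greedy_ordering e x pi :=
  [/\ injective pi,
      [set j | coef e x j != 0] `<=` range pi
    & forall k, `|coef e x (pi k.+1)| <= `|coef e x (pi k)|].

Definition greedy_sum e x pi (N : nat) : X :=
  \sum_(k < N) coef e x (pi k) *: e (pi k).

Definition quasi_greedy e := forall x pi, greedy_ordering e x pi ->
  greedy_sum e x pi @ \oo --> x.

Definition Sigma e (N : nat) : set X :=
  [set y | [set j | coef e y j != 0] #<= `I_N].

Definition proj e (A : {fset nat}) x : X := \sum_(j <- A) coef e x j *: e j.

End basis.

(* The norm of a normed module over K takes its values in K.  For K = R[i]
   these values are real, and the parameter re : K -> R (the identity if K = R,
   the real part if K = R[i]) turns them into elements of R, so that suprema
   and infima can be taken in \bar R. *)
Section constants.
Local Open Scope ereal_scope.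
Context (R : realType) (K : numFieldType) (re : K -> R).
Context (X : completeNormedModType K).
Implicit Types (e : nat -> X) (x : X) (N n : nat).

Definition enorm x : \bar R := (re `|x|)%:E.

Definition sigma e N x : \bar R :=
  ereal_inf [set enorm (x - y)%R | y in Sigma e N].

Definition greedy_const e N : \bar R :=
  ereal_sup [set r | exists x pi, [/\ sigma e N x != 0, greedy_ordering e x pi
    & r = enorm (x - greedy_sum e x pi N)%R / sigma e N x]].

Definition h_left e n : \bar R :=
  ereal_inf [set enorm (\sum_(j <- A) e j)%R
             | A in [set A : {fset nat} | #|` A| = n]].

Definition h_right e n : \bar R :=
  ereal_sup [set enorm (\sum_(j <- A) e j)%R
             | A in [set A : {fset nat} | #|` A| = n]].

(* In \bar R, x / 0 = +oo for x > 0. *)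
Definition democracy_const e N : \bar R :=
  ereal_sup [set h_right e n / h_left e n | n in [set n | (1 <= n <= N)%N]].

Definition op_norm (f : X -> X) : \bar R :=
  ereal_sup [set enorm (f x) | x in [set x | (`|x| <= 1)%R]].

Definition cond_const e N : \bar R :=
  ereal_sup [set op_norm (proj e A)
             | A in [set A : {fset nat} | (#|` A| <= N)%N]].

End constants.

(* Main.v *)
Require Import Defs.
From HB Require Import structures.
From mathcomp Require Import all_boot all_order all_algebra.
From mathcomp Require Import finmap.
From mathcomp Require Import all_classical all_reals all_analysis.
From mathcomp Require Import complex ring lra.

(** The proof has two halves, a qualitative one that produces constants and a
quantitative one that only uses them.

The qualitative half turns pointwise hypotheses into uniform bounds.  For a
Schauder basis, a Baire argument followed by successive approximation bounds the
partial sums ([partial_sums_bounded]) and hence the coefficient functionals.  If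
greedy sums converge for every vector and every greedy ordering, then the
projections on greedy sets (finite sets of indices carrying the largest
coefficients) are uniformly bounded by some [Q]
([greedy_projections_bounded]); otherwise a gliding hump builds one vector with
a greedy ordering along which the greedy sums do not converge to it.

With [Q] at hand the basis is unconditional for constant coefficients, because
every subset of the support of a vector with coefficients of constant modulus is
a greedy set.  Together with summation by parts along a greedy ordering this
gives the key inequality [one_vec_le]: if the coefficients of [z] on [B] have
modulus at least [alpha], then [alpha] times the norm of the sum of the basis
vectors over [B] is at most a constant times the norm of [z].

For the upper bound let [y] be supported on a set [A] of at most [N] indices,
[G] a greedy set of [x] with [N] elements, and [z = x - y].  The remainder is
[x - P_G x = (z - P_(A u G) z) + P_(A - G) x].  The first term is controlled by
projections of [z], that is, by the conditionality constant.  In the second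
term all coefficients are at most the smallest one on [G - A], where [x] and [z]
have the same coefficients, and [G - A] has at least as many elements as
[A - G]; so the democracy constant and the key inequality, applied to [z] itself,
bound it.  Since neither estimate is applied to the outcome of the other, the
maximum of the two constants appears and not their product
([greedy_remainder_le]).

For the lower bound the greedy constant is tested on two kinds of vectors.  On a
sum of basis vectors over disjoint sets [A], [B] of equal size the algorithm may
select [B] and leave the sum over [A], although selecting [A] would leave the
sum over [B], which compares the two sums; the overlap of two general sets is handled by [Q] ([greedy_within_democratic]).  On
the vector obtained from [x] by replacing its coefficients on [A] by a large
constant, the algorithm must select [A] and leaves [x - P_A x], while [x] itself
is an admissible error ([greedy_within_conditional]).

The real and the complex case are treated at once, over a field [K] with a
real part that serves to read norms as real numbers. *)

Set Implicit Arguments.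
Unset Strict Implicit.
Unset Printing Implicit Defensive.

Import Order.TTheory GRing.Theory Num.Theory.
Import numFieldNormedType.Exports.

Local Open Scope classical_set_scope.
Local Open Scope ring_scope.

(** * Scalars, norms and completeness *)

(** A uniform treatment of the real and the complex field.  Norms of a normed
module over [K] lie in [K]; on real elements [re] is inverse to the embedding
[emb] of [R], so [re] turns norms into elements of the ordered field [R], where
they can be compared and combined.  The parts [re] and [im] and the unit [imu]
reduce statements on scalars (completeness, weights of modulus at most 1) to
statements on [R]; over the real field [imu] and [im] are zero. *)
Record scalars (R : realType) (K : numFieldType) (re : K -> R) := Scalars {
  emb : {rmorphism R -> K};
  im : K -> R;
  imu : K;
  embK : cancel emb re;
  reK : forall a : K, a \is Num.real -> emb (re a) = a;
  emb_ge0 : forall r, (0 <= emb r) = (0 <= r);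
  reB : forall a b, re (a - b) = re a - re b;
  imB : forall a b, im (a - b) = im a - im b;
  re_im : forall a, a = emb (re a) + imu * emb (im a);
  re_le : forall a, `|re a| <= re `|a|;
  im_le : forall a, `|im a| <= re `|a|;
  imu_le1 : `|imu| <= 1 }.

Section norm.
Context (R : realType) (K : numFieldType) (re : K -> R) (S : scalars re).
Local Notation emb := (emb S).
Implicit Types (V : normedModType K).

Definition nrm (V : normedZmodType K) (x : V) : R := re `|x|.

Lemma emb_le a b : (emb a <= emb b) = (a <= b).
Proof. by rewrite -subr_ge0 -rmorphB emb_ge0 subr_ge0. Qed.

Lemma emb_lt a b : (emb a < emb b) = (a < b).
Proof. by rewrite !lt_neqAle emb_le (inj_eq (can_inj (embK S))). Qed.

Lemma emb_nrm (V : normedZmodType K) (x : V) : emb (nrm x) = `|x|.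
Proof. by rewrite /nrm reK. Qed.

Lemma nrm_ge0 (V : normedZmodType K) (x : V) : 0 <= nrm x.
Proof. by rewrite -(emb_ge0 S) emb_nrm. Qed.

Lemma nrm_triangle (V : normedZmodType K) (x y : V) :
  nrm (x + y) <= nrm x + nrm y.
Proof. by rewrite -emb_le rmorphD !emb_nrm ler_normD. Qed.

Lemma nrmN (V : normedZmodType K) (x : V) : nrm (- x) = nrm x.
Proof. by rewrite /nrm normrN. Qed.

Lemma nrmB (V : normedZmodType K) (x y : V) : nrm (x - y) = nrm (y - x).
Proof. by rewrite -nrmN opprB. Qed.

Lemma nrm_triangleB (V : normedZmodType K) (x y : V) :
  nrm (x - y) <= nrm x + nrm y.
Proof. by rewrite -(nrmN y) nrm_triangle. Qed.

Lemma nrm_eq0 (V : normedZmodType K) (x : V) : (nrm x == 0) = (x == 0).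
Proof.
by rewrite -(normr_eq0 x) -emb_nrm -(rmorph0 emb) (inj_eq (can_inj (embK S))).
Qed.

Lemma nrm0 (V : normedZmodType K) : nrm (0 : V) = 0.
Proof. by apply/eqP; rewrite nrm_eq0. Qed.

Lemma nrm_gt0 (V : normedZmodType K) (x : V) : (0 < nrm x) = (x != 0).
Proof. by rewrite lt_def nrm_ge0 andbT nrm_eq0. Qed.

Lemma nrmZ V (a : K) (x : V) : nrm (a *: x) = nrm a * nrm x.
Proof. by apply: (can_inj (embK S)); rewrite rmorphM !emb_nrm normrZ. Qed.

Lemma nrmM (a b : K) : nrm (a * b) = nrm a * nrm b.
Proof. by apply: (can_inj (embK S)); rewrite rmorphM !emb_nrm normrM. Qed.

Lemma nrm1 : nrm (1 : K) = 1.
Proof. by rewrite /nrm normr1 -(rmorph1 emb) embK. Qed.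

Lemma nrm_emb r : nrm (emb r) = `|r|.
Proof.
wlog r0 : r / 0 <= r => [H|].
  case: (leP 0 r) => [/H //|/ltW]; rewrite -oppr_ge0 => /H.
  by rewrite rmorphN nrmN normrN.
by rewrite /nrm ger0_norm ?emb_ge0// embK ger0_norm.
Qed.

Lemma nrmV (a : K) : nrm a^-1 = (nrm a)^-1.
Proof.
have [->|a0] := eqVneq a 0; first by rewrite invr0 nrm0 invr0.
have n0 : nrm a != 0 by rewrite nrm_eq0.
by apply: (mulfI n0); rewrite -nrmM !mulfV// nrm1.
Qed.

Lemma nrm_sum (V : normedZmodType K) (I : Type) (s : seq I) (P : pred I) (F : I -> V) :
  nrm (\sum_(i <- s | P i) F i) <= \sum_(i <- s | P i) nrm (F i).
Proof.
elim/big_ind2: _ => [|x y z t h1 h2|//]; first by rewrite nrm0.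
by apply: le_trans (nrm_triangle _ _) _; apply: lerD.
Qed.

(** Convergence and the Cauchy property are stated with the real-valued norm,
so that they can be used for vectors and for scalars alike, without a filter on
[K]. *)
Definition cvs (V : normedZmodType K) (u : nat -> V) (x : V) :=
  forall eps : R, 0 < eps -> exists n0, forall n, (n0 <= n)%N -> nrm (u n - x) < eps.

Definition cauchys (V : normedZmodType K) (u : nat -> V) :=
  forall eps : R, 0 < eps ->
    exists n0, forall n, (n0 <= n)%N -> nrm (u n - u n0) < eps.

Lemma cvsP V (u : nat -> V) x : u @ \oo --> x <-> cvs u x.
Proof.
split.
  move=> /cvgrPdist_lt H eps e0.
  have /H [n0 _ Hn] : 0 < emb eps by rewrite -(rmorph0 emb) emb_lt.
  by exists n0 => n /Hn /=; rewrite nrmB -emb_lt emb_nrm.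
move=> H; apply/cvgrPdist_lt => eps e0.
have rE : emb (re eps) = eps by apply: reK; exact: gtr0_real.
have /H [n0 Hn] : 0 < re eps by rewrite -emb_lt rmorph0 rE.
by exists n0 => // n /Hn /=; rewrite nrmB -emb_lt emb_nrm rE.
Qed.

Lemma cvs_unique (V : normedZmodType K) (u : nat -> V) x y : cvs u x -> cvs u y -> x = y.
Proof.
move=> ux uy; apply/eqP/contraT; rewrite -subr_eq0 -nrm_gt0 => d0.
have d20 : 0 < nrm (x - y) / 2 by lra.
have [n1 h1] := ux _ d20; have [n2 h2] := uy _ d20.
have := h1 _ (leq_maxl n1 n2); have := h2 _ (leq_maxr n1 n2).
set n := maxn n1 n2 => l2 l1.
have := nrm_triangleB (u n - y) (u n - x).
have -> : u n - y - (u n - x) = x - y by rewrite opprB addrC subrKA.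
by move=> ?; lra.
Qed.

Lemma cvs_nrm_le (V : normedZmodType K) (u : nat -> V) x y (M : R) n0 :
  cvs u x -> (forall n, (n0 <= n)%N -> nrm (u n - y) <= M) -> nrm (x - y) <= M.
Proof.
move=> ux le; apply/ler_addgt0Pr => eps e0.
have [n1 h] := ux _ e0.
have := h _ (leq_maxl n1 n0); have := le _ (leq_maxr n1 n0).
set n := maxn n1 n0 => h1 h2.
have := nrm_triangleB (u n - y) (u n - x).
have -> : u n - y - (u n - x) = x - y by rewrite opprB addrC subrKA.
by move=> ?; lra.
Qed.

Lemma cvs_bounded (V : normedZmodType K) (u : nat -> V) x :
  cvs u x -> exists M, forall n, nrm (u n) <= M.
Proof.
move=> ux; have [n0 h] := ux 1 ltr01.
exists (\sum_(i < n0) nrm (u i) + (nrm x + 1)) => n.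
have s0 : 0 <= \sum_(i < n0) nrm (u i) by apply: sumr_ge0 => ? _; exact: nrm_ge0.
case: (ltnP n n0) => [ln|/h ge].
  rewrite (bigD1 (Ordinal ln)) //=; have := nrm_ge0 x.
  have : 0 <= \sum_(i < n0 | i != Ordinal ln) nrm (u i).
    by apply: sumr_ge0 => ? _; exact: nrm_ge0.
  by lra.
have := nrm_triangle (u n - x) x; rewrite subrK; lra.
Qed.

Lemma cvsD (V : normedZmodType K) (u v : nat -> V) x y :
  cvs u x -> cvs v y -> cvs (fun n => u n + v n) (x + y).
Proof.
move=> ux vy eps e0; have e20 : 0 < eps / 2 by lra.
have [n1 h1] := ux _ e20; have [n2 h2] := vy _ e20.
exists (maxn n1 n2) => n; rewrite geq_max => /andP[/h1 l1 /h2 l2].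
by rewrite opprD addrACA; apply: le_lt_trans (nrm_triangle _ _) _; lra.
Qed.

Lemma cvs_const (V : normedZmodType K) (x : V) : cvs (fun=> x) x.
Proof. by move=> eps e0; exists 0 => n _; rewrite subrr nrm0. Qed.

Lemma cvs_ext (V : normedZmodType K) (u v : nat -> V) x :
  u =1 v -> cvs u x -> cvs v x.
Proof. by move=> uv ux eps /ux[n0 h]; exists n0 => n /h; rewrite uv. Qed.

Lemma cvs_eventually_const (V : normedZmodType K) (u : nat -> V) x y n0 :
  (forall n, (n0 <= n)%N -> u n = y) -> cvs u x -> x = y.
Proof.
move=> uy ux; apply: (cvs_unique ux) => eps e0; exists n0 => n /uy ->.
by rewrite subrr nrm0.
Qed.

Lemma cvsZr V (a : K) (u : nat -> V) x :
  cvs u x -> cvs (fun n => a *: u n) (a *: x).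
Proof.
move=> ux eps e0.
have a0 : 0 < nrm a + 1 by have := nrm_ge0 a; lra.
have [n0 h] := ux _ (divr_gt0 e0 a0).
exists n0 => n /h; rewrite ltr_pdivlMr// -scalerBr nrmZ.
by apply: le_lt_trans; rewrite mulrC ler_wpM2l ?nrm_ge0//; lra.
Qed.

Lemma cvsZl V (a : nat -> K) (b : K) (x : V) :
  cvs a b -> cvs (fun n => a n *: x) (b *: x).
Proof.
move=> ab eps e0.
have x0 : 0 < nrm x + 1 by have := nrm_ge0 x; lra.
have [n0 h] := ab _ (divr_gt0 e0 x0).
exists n0 => n /h; rewrite ltr_pdivlMr// -scalerBl nrmZ.
by apply: le_lt_trans; rewrite ler_wpM2l ?nrm_ge0//; lra.
Qed.

Lemma cvs_sum (V : normedZmodType K) (I : Type) (s : seq I) (u : I -> nat -> V) (x : I -> V) :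
  (forall i, cvs (u i) (x i)) ->
  cvs (fun n => \sum_(i <- s) u i n) (\sum_(i <- s) x i).
Proof.
move=> ux; elim: s => [|i s IH].
  by rewrite big_nil; apply: cvs_ext (cvs_const 0) => n; rewrite big_nil.
rewrite big_cons; apply: cvs_ext (cvsD (ux i) IH) => n.
by rewrite big_cons.
Qed.

Lemma cauchys_cvs (X : completeNormedModType K) (u : nat -> X) :
  cauchys u -> exists x, cvs u x.
Proof.
move=> cu; have /cvg_ex[x ux] : cvg (u @ \oo).
  apply: cauchy_cvg; apply: cauchy_exP => eps e0.
  have rE : emb (re eps) = eps by apply: reK; exact: gtr0_real.
  have /cu [n0 Hn] : 0 < re eps by rewrite -emb_lt rmorph0 rE.
  exists (u n0); exists n0 => // n /Hn /=.
  by rewrite nrmB -emb_lt emb_nrm rE -ball_normE.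
by exists x; apply/cvsP.
Qed.

Lemma cauchys_cvs_real (u : nat -> R) :
  (forall eps, 0 < eps -> exists n0, forall n, (n0 <= n)%N -> `|u n - u n0| < eps) ->
  exists x, forall eps, 0 < eps -> exists n0, forall n, (n0 <= n)%N -> `|u n - x| < eps.
Proof.
move=> cu; have /cvg_ex[x /cvgrPdist_lt ux] : cvg (u @ \oo).
  apply: cauchy_cvg; apply: cauchy_exP => eps /cu [n0 Hn].
  exists (u n0); exists n0 => // n /Hn /=.
  by rewrite distrC -ball_normE.
by exists x => eps /ux[n0 _ h]; exists n0 => n /h /=; rewrite distrC.
Qed.

(** The scalar field is complete because its real and imaginary parts are. *)
Lemma cauchys_cvs_scalar (a : nat -> K) : cauchys a -> exists b, cvs a b.
Proof.
move=> ca.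
have [|x hx] := @cauchys_cvs_real (fun n => re (a n)).
  move=> eps /ca[n0 h]; exists n0 => n /h; rewrite -(reB S).
  by apply: le_lt_trans; exact: re_le.
have [|y hy] := @cauchys_cvs_real (fun n => im S (a n)).
  move=> eps /ca[n0 h]; exists n0 => n /h; rewrite -imB.
  by apply: le_lt_trans; exact: im_le.
exists (emb x + imu S * emb y) => eps e0.
have e20 : 0 < eps / 2 by lra.
have [n1 h1] := hx _ e20; have [n2 h2] := hy _ e20.
exists (maxn n1 n2) => n; rewrite geq_max => /andP[/h1 l1 /h2 l2].
have -> : a n - (emb x + imu S * emb y)
    = emb (re (a n) - x) + imu S * emb (im S (a n) - y).
  by rewrite !rmorphB {1}(re_im S (a n)); ring.
apply: le_lt_trans (nrm_triangle _ _) _.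
rewrite nrmM !nrm_emb.
have : nrm (imu S) <= 1 by rewrite -emb_le emb_nrm rmorph1 imu_le1.
have := normr_ge0 (im S (a n) - y); have := nrm_ge0 (imu S); nra.
Qed.

(** Geometric error terms are eventually small: all the series below converge
by comparison with the powers of one half. *)
Lemma ex_half_lt (C eps : R) : 0 < eps -> exists k, C * 2^-1 ^+ k < eps.
Proof.
move=> e0; pose k := (Num.truncn (`|C| / eps)).+1; exists k.
have kC : `|C| / eps < k%:R by exact: truncnS_gt.
have k2 : k%:R <= 2 ^+ k :> R by rewrite -natrX ler_nat ltnW// ltn_expl.
rewrite exprVn ltr_pdivrMr ?exprn_gt0//.
apply: le_lt_trans (ler_norm C) _.
rewrite ltr_pdivrMr// in kC; rewrite mulrC; nra.
Qed.

(** The Baire category theorem in the form used for linear problems: if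
countably many sets cover a complete space, one of them is dense in a ball.
Otherwise each set misses a ball inside any given ball, and a nested sequence
of such balls shrinks to a point outside all the sets. *)
Lemma baire_dense_in_ball (X : completeNormedModType K) (F : nat -> set X) :
  (forall x, exists n, F n x) ->
  exists n c (r : R), 0 < r /\ forall y, nrm (y - c) < r ->
    forall eps : R, 0 < eps -> exists2 z, F n z & nrm (y - z) < eps.
Proof.
move=> cover; apply: contrapT => nodense.
have step (p : nat * (X * R)) : exists q : X * R, 0 < p.2.2 ->
    [/\ 0 < q.2, q.2 <= p.2.2 / 2, nrm (q.1 - p.2.1) + q.2 <= p.2.2
      & forall z, F p.1 z -> q.2 < nrm (q.1 - z)].
  case: p => n [c r] /=.
  have [r0|] := boolP (0 < r); last by exists (0, 0).
  have [y [yr [eps [e0 he]]]] : exists y, nrm (y - c) < r /\ exists eps : R,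
      0 < eps /\ forall z, F n z -> eps <= nrm (y - z).
    apply: contrapT => H; apply: nodense; exists n, c, r; split => // y yr eps e0.
    apply: contrapT => H1; apply: H; exists y; split => //; exists eps; split => // z Fz.
    by rewrite leNgt; apply/negP => lt; apply: H1; exists z.
  (* The radius eps / 2 excludes F n, the last bound keeps the new ball inside
     the old one, and r / 2 makes the centres a Cauchy sequence. *)
  exists (y, Num.min (eps / 2) (Num.min (r / 2) ((r - nrm (y - c))))) => _ /=.
  have d0 : 0 < r - nrm (y - c) by lra.
  split.
  - by rewrite !lt_min; apply/and3P; split => //; lra.
  - by rewrite !ge_min lexx orbT.
  - have : Num.min (eps / 2) (Num.min (r / 2) (r - nrm (y - c))) <= r - nrm (y - c).
      by rewrite !ge_min lexx !orbT.
    by lra.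
  - move=> z /he le; apply: le_lt_trans (_ : _ <= eps / 2) _; last by lra.
    by rewrite !ge_min lexx.
have [f fP] := choice step.
pose fix ar n : X * R := if n is p.+1 then f (p, ar p) else (0, 1).
have r0 n : 0 < (ar n).2.
  elim: n => [|n IH] /=; first exact: ltr01.
  by have [] := fP (n, ar n) IH.
have P n := fP (n, ar n) (r0 n).
have rn n : (ar n).2 <= 2^-1 ^+ n.
  elim: n => [|n IH]; first by rewrite expr0 /= lexx.
  by have [_ h _ _] := P n; apply: le_trans h _; rewrite exprS /=; lra.
have nest n k : nrm ((ar (n + k)%N).1 - (ar n).1) + (ar (n + k)%N).2 <= (ar n).2.
  elim: k => [|k IH]; first by rewrite addn0 subrr nrm0 add0r.
  rewrite addnS; have [_ _ h _] := P (n + k)%N; move: h => /=.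
  have := nrm_triangle ((f ((n + k)%N, ar (n + k)%N)).1 - (ar (n + k)%N).1)
    ((ar (n + k)%N).1 - (ar n).1).
  rewrite addrA subrK; move: IH; lra.
have [|l hl] := @cauchys_cvs X (fun n => (ar n).1).
  move=> eps /(ex_half_lt 1)[n0]; rewrite mul1r => hn.
  exists n0 => n /subnKC <-; have := nest n0 (n - n0)%N; have := rn n0.
  by have := r0 (n0 + (n - n0))%N; lra.
have lin n : nrm (l - (ar n).1) <= (ar n).2.
  apply: (@cvs_nrm_le _ _ _ _ _ n hl) => m /subnKC <-.
  by have := nest n (m - n)%N; have := r0 (n + (m - n))%N; lra.
have [n Fl] := cover l.
have [_ _ _ /(_ _ Fl)] := P n; rewrite ltNge => /negP; apply.
by rewrite nrmB; exact: (lin n.+1).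
Qed.

End norm.

(** * Schauder bases: bounded partial sums and coefficients *)

Section schauder.
Context (R : realType) (K : numFieldType) (re : K -> R) (S : scalars re).
Context (X : completeNormedModType K) (e : nat -> X).
Hypotheses (basis_e : schauder_basis e) (norm_e : normalized e).
Local Notation emb := (emb S).
Local Notation nrm := (nrm re).
Local Notation coef := (coef e).
Local Notation proj := (Defs.proj e).

Definition expands (x : X) (a : nat -> K) :=
  cvs re (fun n => \sum_(j < n) a j *: e j) x.

Lemma expandsP x a : expansion e x a <-> expands x a.
Proof.
rewrite /expansion; split => [/(cvsP S)|].
  by apply: cvs_ext => n; rewrite /series /= big_mkord.
move=> h; apply/(cvsP S); apply: cvs_ext h => n.
by rewrite /series /= big_mkord.
Qed.

Lemma coef_expands x : expands x (coef x).
Proof.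
by apply/expandsP; have [a [ha _]] := basis_e x; exact: (xgetI _ ha).
Qed.

Lemma expands_coef x a : expands x a -> a = coef x.
Proof.
move=> /expandsP xa; have [b [hb ub]] := basis_e x.
by rewrite -(ub _ xa); apply: ub; apply/expandsP; exact: coef_expands.
Qed.

Lemma nrm_e j : nrm (e j) = 1.
Proof. by rewrite /nrm norm_e -(rmorph1 emb) (embK S). Qed.

Lemma nrm_Ze a j : nrm (a *: e j) = nrm a.
Proof. by rewrite (nrmZ S) nrm_e mulr1. Qed.

Lemma coefD x y j : coef (x + y) j = coef x j + coef y j.
Proof.
suff -> : coef (x + y) = fun j => coef x j + coef y j by [].
apply/esym/expands_coef.
apply: cvs_ext (cvsD S (coef_expands x) (coef_expands y)) => n.
by rewrite -big_split; apply: eq_bigr => i _; rewrite scalerDl.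
Qed.

Lemma coefZ a x j : coef (a *: x) j = a * coef x j.
Proof.
suff -> : coef (a *: x) = fun j => a * coef x j by [].
apply/esym/expands_coef.
apply: cvs_ext (cvsZr S a (coef_expands x)) => n.
by rewrite scaler_sumr; apply: eq_bigr => i _; rewrite scalerA.
Qed.

Lemma coefN x j : coef (- x) j = - coef x j.
Proof. by rewrite -scaleN1r coefZ mulN1r. Qed.

Lemma coefB x y j : coef (x - y) j = coef x j - coef y j.
Proof. by rewrite coefD coefN. Qed.

Lemma coef0 j : coef 0 j = 0.
Proof. by rewrite -(subrr 0) coefB subrr. Qed.

Lemma coef_sum (I : Type) (s : seq I) (P : pred I) (F : I -> X) j :
  coef (\sum_(i <- s | P i) F i) j = \sum_(i <- s | P i) coef (F i) j.
Proof. by apply: (big_morph (coef ^~ j)) => [x y|]; rewrite (coefD, coef0). Qed.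

Lemma coef_e i j : coef (e i) j = (j == i)%:R.
Proof.
suff <- : (fun j => (j == i)%:R) = coef (e i) by [].
apply: expands_coef => eps e0; exists i.+1 => n ni.
rewrite (bigD1 (Ordinal ni)) //= eqxx scale1r big1 ?addr0 ?subrr ?(nrm0 S)//.
by move=> k /eqP/val_eqP /= /negbTE ->; rewrite scale0r.
Qed.

Lemma coef_fset_sum (A : {fset nat}) (b : nat -> K) j :
  coef (\sum_(i <- A) b i *: e i) j = if j \in A then b j else 0.
Proof.
rewrite coef_sum; case: ifP => jA.
  rewrite (big_fsetD1 j) //= coefZ coef_e eqxx mulr1 big1_seq ?addr0// => i /=.
  by rewrite !inE eq_sym => /andP[/negbTE ij _]; rewrite coefZ coef_e ij mulr0.
rewrite big1_seq// => i /= iA; rewrite coefZ coef_e.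
by case: eqP => [ji|]; rewrite ?mulr0//; move: jA; rewrite ji iA.
Qed.

Lemma coef_ord_sum n (b : nat -> K) j :
  coef (\sum_(i < n) b i *: e i) j = if (j < n)%N then b j else 0.
Proof.
rewrite coef_sum; case: ifP => jn.
  rewrite (bigD1 (Ordinal jn)) //= coefZ coef_e eqxx mulr1 big1 ?addr0// => i.
  rewrite eq_sym -val_eqE /= => /negbTE ij.
  by rewrite coefZ coef_e ij mulr0.
rewrite big1// => i _; rewrite coefZ coef_e.
by case: eqP => [ji|]; rewrite ?mulr0//; move: jn; rewrite ji ltn_ord.
Qed.

Definition partial_sum n x := \sum_(j < n) coef x j *: e j.

Lemma coef_partial_sum n x j : coef (partial_sum n x) j = if (j < n)%N then coef x j else 0.
Proof. exact: coef_ord_sum. Qed.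

Lemma coef_proj A x j : coef (proj A x) j = if j \in A then coef x j else 0.
Proof. exact: coef_fset_sum. Qed.

Lemma partial_sumB n x y : partial_sum n (x - y) = partial_sum n x - partial_sum n y.
Proof. by rewrite -sumrB; apply: eq_bigr => i _; rewrite coefB scalerBl. Qed.

Lemma partial_sumZ n a x : partial_sum n (a *: x) = a *: partial_sum n x.
Proof. by rewrite scaler_sumr; apply: eq_bigr => i _; rewrite coefZ scalerA. Qed.

Lemma partial_sum0 n : partial_sum n 0 = 0.
Proof. by rewrite -(subrr 0) partial_sumB !subrr. Qed.

Lemma projZ A a x : proj A (a *: x) = a *: proj A x.
Proof. by rewrite scaler_sumr; apply: eq_bigr => i _; rewrite coefZ scalerA. Qed.

Lemma coef_inj x y : coef x =1 coef y -> x = y.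
Proof.
move=> xy; apply: (cvs_unique S (coef_expands x)).
by apply: cvs_ext (coef_expands y) => n; apply: eq_bigr => i _; rewrite -xy.
Qed.

Lemma nrm_coef x j : nrm (coef x j) = nrm (partial_sum j.+1 x - partial_sum j x).
Proof. by rewrite /partial_sum big_ord_recr /= [X in X - _]addrC addrK nrm_Ze. Qed.

(** The Baire step towards bounded partial sums.  The sets [F M] of vectors all
of whose partial sums have norm at most [M] cover the space, so one of them is
dense in a ball; the differences of its elements are dense in a ball about the
origin, with partial sums at most [2 * M], and scaling gives a constant [C] that
serves every vector. *)
Lemma half_approximation : exists C : R, 0 <= C /\ forall y, exists z,
  (forall n, nrm (partial_sum n z) <= C * nrm y) /\ nrm (y - z) <= nrm y / 2.
Proof.
pose F (M : nat) := [set x | forall n, nrm (partial_sum n x) <= M%:R].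
have [x|M [c [r [r0 dense]]]] := @baire_dense_in_ball R K re S X F.
  have [M hM] := cvs_bounded S (coef_expands x).
  exists (Num.truncn M).+1 => n; apply: le_trans (hM n) _.
  by rewrite ltW// truncnS_gt.
exists (4 * M%:R / r); split; first by rewrite !mulr_ge0// invr_ge0 ltW.
move=> y; have [->|y0] := eqVneq y 0.
  exists 0; rewrite (nrm0 S) subrr (nrm0 S) mulr0 mul0r; split=> [n|]; last exact: lexx.
  by rewrite partial_sum0 (nrm0 S).
have ny : 0 < nrm y by rewrite (nrm_gt0 S).
pose t := r / (2 * nrm y).
have t0 : 0 < t by rewrite divr_gt0// mulr_gt0.
have nt : nrm (emb t *: y) = r / 2.
  by rewrite (nrmZ S) (nrm_emb S) gtr0_norm// /t; field; rewrite gt_eqF.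
have r8 : 0 < r / 8 by lra.
have [|z1 Fz1 hz1] := dense (emb t *: y + c) _ _ r8.
  by rewrite addrK nt; lra.
have [|z2 Fz2 hz2] := dense c _ _ r8; first by rewrite subrr (nrm0 S).
exists (emb t^-1 *: (z1 - z2)); split => [n|].
  rewrite partial_sumZ partial_sumB (nrmZ S) (nrm_emb S) gtr0_norm ?invr_gt0//.
  have -> : 4 * M%:R / r * nrm y = t^-1 * (M%:R + M%:R).
    by rewrite /t; field; rewrite !gt_eqF.
  rewrite ler_pM2l ?invr_gt0//; apply: le_trans (nrm_triangleB S _ _) _.
  exact: lerD.
have tK : y = emb t^-1 *: (emb t *: y).
  by rewrite scalerA -rmorphM mulVf ?gt_eqF// rmorph1 scale1r.
rewrite {1}tK -scalerBr (nrmZ S) (nrm_emb S) gtr0_norm ?invr_gt0//.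
have -> : nrm y / 2 = t^-1 * (r / 4) by rewrite /t; field; rewrite !gt_eqF.
rewrite ler_pM2l ?invr_gt0//.
have -> : emb t *: y - (z1 - z2) = (emb t *: y + c - z1) - (c - z2).
  by rewrite !opprB [X in X + (z2 - c)]addrAC -(addrA (_ - z1)) subrKC addrA addrAC.
by apply: le_trans (nrm_triangleB S _ _) _; lra.
Qed.

(** The closure left by the Baire step is removed by successive approximation.
Iterating [half_approximation] on the successive errors writes [x] as the limit
of vectors [w k] whose partial sums converge as [k] grows, uniformly in their
length.  The limits of the coefficients of [w k] therefore expand [x], hence are
the coefficients of [x], and the bound passes to the limit. *)
Lemma partial_sums_bounded : exists kap : R, 1 <= kap /\
  forall n x, nrm (partial_sum n x) <= kap * nrm x.
Proof.
have [C [C0 /choice[z hz]]] := half_approximation.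
exists (2 * C + 1); split; first by lra.
move=> n x; suff : nrm (partial_sum n x) <= 2 * C * nrm x by have := nrm_ge0 S x; nra.
pose fix y k := if k is l.+1 then y l - z (y l) else x.
have ny k : nrm (y k) <= 2^-1 ^+ k * nrm x.
  elim: k => [|k IH]; first by rewrite expr0 mul1r.
  by have [_] := hz (y k); rewrite exprS /=; lra.
pose w k := x - y k.
have wstep k m : nrm (partial_sum m (w k.+1) - partial_sum m (w k)) <= C * (2^-1 ^+ k * nrm x).
  have -> : partial_sum m (w k.+1) - partial_sum m (w k) = partial_sum m (z (y k)).
    by rewrite -partial_sumB /w /= !opprB (addrA x) addrA subrK addrC addKr.
  have [/(_ m) h _] := hz (y k); apply: le_trans h _.
  by rewrite ler_wpM2l.
have wtail k l m : nrm (partial_sum m (w (k + l)%N) - partial_sum m (w k)) <=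
    2 * C * nrm x * (2^-1 ^+ k - 2^-1 ^+ (k + l)).
  elim: l => [|l IH]; first by rewrite addn0 !subrr (nrm0 S) mulr0.
  have := wstep (k + l)%N m; have := nrm_triangle S
    (partial_sum m (w (k + l).+1) - partial_sum m (w (k + l)%N))
    (partial_sum m (w (k + l)%N) - partial_sum m (w k)).
  by rewrite addrA subrK addnS (exprS _ (k + l)); lra.
have wle k l m : (k <= l)%N ->
    nrm (partial_sum m (w l) - partial_sum m (w k)) <= 2 * C * nrm x * 2^-1 ^+ k.
  move=> /subnKC <-; apply: le_trans (wtail _ _ _) _.
  rewrite ler_wpM2l ?mulr_ge0 ?(nrm_ge0 S)//.
  by have : 0 <= 2^-1 ^+ (k + (l - k)) :> R by []; lra.
have /choice[b hb] : forall j, exists b, cvs re (fun k => coef (w k) j) b.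
  move=> j; apply: (cauchys_cvs_scalar S) => eps e0.
  have [k0 hk] := ex_half_lt (4 * C * nrm x) e0.
  exists k0 => k kk; rewrite -coefB nrm_coef (partial_sumB j.+1 (w k)) (partial_sumB j (w k)).
  have := wle _ _ j kk; have := wle _ _ j.+1 kk.
  have := nrm_triangleB S (partial_sum j.+1 (w k) - partial_sum j.+1 (w k0))
    (partial_sum j (w k) - partial_sum j (w k0)).
  by lra.
pose s m := \sum_(j < m) b j *: e j.
have sw m : cvs re (fun k => partial_sum m (w k)) (s m).
  by apply: cvs_sum => // i; apply: cvsZl.
have sle k m : nrm (s m - partial_sum m (w k)) <= 2 * C * nrm x * 2^-1 ^+ k.
  by apply: (cvs_nrm_le S (n0 := k) (sw m)) => l kl; exact: wle.
have bx : expands x b.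
  move=> eps e0.
  have e20 : 0 < eps / 2 by lra.
  have [k hk] := ex_half_lt ((2 * C + 1) * nrm x) e20.
  have [n0 hn] := coef_expands (w k) e20.
  exists n0 => m /hn hm; have := sle k m; have := ny k.
  have := nrm_triangleB S (s m - partial_sum m (w k) + (partial_sum m (w k) - w k)) (y k).
  have := nrm_triangle S (s m - partial_sum m (w k)) (partial_sum m (w k) - w k).
  have -> : s m - partial_sum m (w k) + (partial_sum m (w k) - w k) - y k = s m - x.
    by rewrite addrA subrK /w opprB addrAC subrKA.
  by move: hm; rewrite /partial_sum; lra.
(* w 0 is the zero vector, so the case k = 0 of sle bounds partial_sum n x itself. *)
have -> : partial_sum n x = s n - partial_sum n (w 0%N).
  by rewrite /w /= subrr partial_sum0 subr0 /partial_sum /s -(expands_coef bx).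
by apply: le_trans (sle 0%N n) _; rewrite expr0 mulr1.
Qed.

(** The constants that the later arguments take from the basis: [kap] for the
partial sums and, since the modulus of a coefficient is the norm of a difference
of two consecutive partial sums, [2 * kap] for the coefficient functionals. *)
Lemma coef_bounded : exists kap : R, [/\ 1 <= kap,
  forall n x, nrm (partial_sum n x) <= kap * nrm x
  & forall x j, nrm (coef x j) <= 2 * kap * nrm x].
Proof.
have [kap [k1 hk]] := partial_sums_bounded; exists kap; split=> // x j.
rewrite nrm_coef; apply: le_trans (nrm_triangleB S _ _) _.
by have := hk j x; have := hk j.+1 x; lra.
Qed.

Lemma coef_cvs0 x (eps : R) : 0 < eps ->
  exists n0, forall j, (n0 <= j)%N -> nrm (coef x j) < eps.
Proof.
move=> e0; have e20 : 0 < eps / 2 by lra.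
have [n0 h] := coef_expands x e20; exists n0 => j nj.
rewrite nrm_coef.
have := nrm_triangleB S (partial_sum j.+1 x - x) (partial_sum j x - x).
have -> : partial_sum j.+1 x - x - (partial_sum j x - x) = partial_sum j.+1 x - partial_sum j x.
  by rewrite opprB addrA subrK.
have := h _ nj; have := h _ (leqW nj); rewrite -/(partial_sum j x) -/(partial_sum j.+1 x); lra.
Qed.

End schauder.

(** * Greedy sets and greedy orderings *)

Section greedy_enumeration.
Context (R : realType) (a : nat -> R).
Hypotheses (a_ge0 : forall j, 0 <= a j)
  (a_cvg0 : forall eps, 0 < eps -> exists n, forall j, (n <= j)%N -> a j < eps).

Lemma argmax_lt (P : nat -> Prop) n : (exists2 j, (j < n)%N & P j) ->
  exists j, P j /\ forall i, (i < n)%N -> P i -> a i <= a j.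
Proof.
elim: n => [|n IH] [j]; first by rewrite ltn0.
rewrite ltnS leq_eqVlt => jn Pj.
have [Pn|nPn] := pselect (P n); last first.
  have jn' : (j < n)%N by case/orP: jn => // /eqP jn; rewrite jn in Pj.
  have [i [Pi hi]] := IH (ex_intro2 _ _ j jn' Pj); exists i; split => // k.
  by rewrite ltnS leq_eqVlt => /orP[/eqP -> //|]; exact: hi.
have [ex|nex] := pselect (exists2 j, (j < n)%N & P j); last first.
  exists n; split => // k; rewrite ltnS leq_eqVlt => /orP[/eqP -> //|kn Pk].
  by exfalso; apply: nex; exists k.
have [i [Pi hi]] := IH ex.
have [le|lt] := leP (a n) (a i).
  by exists i; split => // k; rewrite ltnS leq_eqVlt => /orP[/eqP -> //|]; exact: hi.
exists n; split => // k; rewrite ltnS leq_eqVlt => /orP[/eqP -> //|kn Pk].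
by apply: le_trans (hi _ kn Pk) _; exact: ltW.
Qed.

(** Only finitely many indices exceed a given positive value, so a maximum
exists on every nonempty set of indices, finite or not. *)
Lemma c0_argmax (P : nat -> Prop) : (exists j, P j) ->
  exists j, P j /\ forall i, P i -> a i <= a j.
Proof.
move=> [j0 Pj0].
have [[j [Pj aj]]|H] := pselect (exists j, P j /\ 0 < a j); last first.
  exists j0; split => // i Pi; apply: le_trans (_ : 0 <= _) => //.
  by rewrite leNgt; apply/negP => ai; apply: H; exists i.
have [n hn] := a_cvg0 aj.
have jn : (j < n)%N by rewrite ltnNge; apply/negP => /hn; rewrite ltxx.
have [i [Pi hi]] := @argmax_lt P n (ex_intro2 _ _ j jn Pj).
exists i; split => // k Pk; case: (ltnP k n) => [/hi/(_ Pk)//|/hn/ltW ak].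
by apply: le_trans ak _; exact: hi.
Qed.

Lemma fresh (B : {fset nat}) : exists M, forall j, j \in B -> (j < M)%N.
Proof.
exists (\max_(j <- B) j).+1 => j jB; rewrite ltnS.
by rewrite (big_fsetD1 j) //= leq_maxl.
Qed.

(** A decreasing enumeration may be required to run through any prescribed
increasing sequence of greedy sets: the next index is a largest one among those
left, taken from the first unfinished set of the sequence.  Every index with
[a j != 0] is reached, since otherwise [a] would stay above [a j]. *)
Lemma greedy_enumeration (D : nat -> {fset nat}) :
  (forall m, D m `<=` D m.+1)%fset ->
  (forall m i j, i \in D m -> j \notin D m -> a j <= a i) ->
  exists pi : nat -> nat, [/\ injective pi,
    forall k, a (pi k.+1) <= a (pi k),
    forall j, a j != 0 -> exists k, pi k = j
    & forall m, perm_eq (D m) (mkseq pi #|` D m|)].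
Proof.
move=> Dmono Dgreedy.
have Dm m n : (m <= n)%N -> (D m `<=` D n)%fset.
  move=> /subnKC <-; elim: (n - m)%N => [|k IH]; rewrite ?addn0 ?fsubset_refl//.
  by rewrite addnS; apply: fsubset_trans IH _.
have nxt_ex (B : {fset nat}) : exists j, [/\ j \notin B,
    forall i, i \notin B -> a i <= a j
    & forall m, ~~ (D m `<=` B)%fset -> j \in D m].
  have [ex|nex] := pselect (exists m, ~~ (D m `<=` B)%fset); last first.
    have [|j [jB hj]] := @c0_argmax (fun j => j \notin B).
      by have [M hM] := fresh B; exists M; apply/negP => /hM; rewrite ltnn.
    by exists j; split => // m Dmn; exfalso; apply: nex; exists m.
  have [m mB mmin] := ex_minnP ex.
  have [|j [/andP[jB jD] hj]] := @c0_argmax (fun j => (j \notin B) && (j \in D m)).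
    by have /fsubsetPn[j jD jB] := mB; exists j; rewrite jB.
  exists j; split => // [i iB|n nB].
    have [iD|iD] := boolP (i \in D m); first by apply: hj; rewrite iB.
    exact: Dgreedy jD iD.
  by apply: (fsubsetP (Dm _ _ (mmin _ nB))).
have [nxt nxtP] := choice nxt_ex.
pose fix pre n := if n is k.+1 then (nxt (pre k) |` pre k)%fset else fset0.
pose pi n := nxt (pre n).
have preS n : pre n.+1 = (pi n |` pre n)%fset by [].
have pi_pre n : pi n \notin pre n by have [] := nxtP (pre n).
have card_pre n : #|` pre n| = n.
  by elim: n => [|n IH]; rewrite ?cardfs0// preS cardfsU1 pi_pre IH add1n.
have pre_pi n : pre n =i mkseq pi n.
  move=> j; elim: n => [|n IH]; first by rewrite in_fset0.
  by rewrite preS in_fset1U /mkseq -addn1 iotaD map_cat mem_cat -/(mkseq pi n) -IH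
    add0n /= inE orbC.
have pi_in k n : (k < n)%N -> pi k \in pre n.
  by move=> kn; rewrite pre_pi; apply/mapP; exists k; rewrite ?mem_iota.
have pi_inj : injective pi.
  move=> k l kl; case: (ltngtP k l) => // lt.
    by have := pi_pre l; rewrite -kl pi_in.
  by have := pi_pre k; rewrite kl pi_in.
exists pi; split => //.
- move=> k; have [_ h _] := nxtP (pre k); apply: h.
  by have := pi_pre k.+1; rewrite preS in_fset1U negb_or => /andP[].
- move=> j aj; apply: contrapT => nj.
  have a0 : 0 < a j by rewrite lt_def aj a_ge0.
  have jpre n : j \notin pre n.
    by apply/negP; rewrite pre_pi => /mapP[k _ jk]; apply: nj; exists k.
  have lej k : a j <= a (pi k) by have [_ h _] := nxtP (pre k); exact: h.
  have [n hn] := a_cvg0 a0.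
  have pin k : (pi k < n)%N.
    by rewrite ltnNge; apply/negP => /hn; rewrite ltNge lej.
  have : (#|` pre n.+1| <= #|` [fset j in iota 0 n]%fset|)%N.
    apply: fsubset_leq_card; apply/fsubsetP => i; rewrite pre_pi => /mapP[k _ ->].
    by rewrite in_fset mem_iota add0n pin.
  by rewrite card_pre card_fseq undup_id ?iota_uniq// size_iota ltnn.
- move=> m; set N := #|` D m|.
  have sub n : (n <= N)%N -> (pre n `<=` D m)%fset.
    elim: n => [_|n IH nN]; first exact: fsub0set.
    rewrite preS fsubUset (IH (ltnW nN)) andbT fsub1set.
    have [_ _ h] := nxtP (pre n); apply: h.
    by apply/negP => /fsubset_leq_card; rewrite card_pre leqNgt nN.
  have eqD : pre N = D m.
    by apply/eqP; rewrite eqEfcard sub//= card_pre.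
  apply: uniq_perm; rewrite ?fset_uniq// ?map_inj_uniq ?iota_uniq// => j.
  by rewrite -eqD pre_pi.
Qed.

End greedy_enumeration.

Section greedy_sets.
Context (R : realType) (K : numFieldType) (re : K -> R) (S : scalars re).
Context (X : completeNormedModType K) (e : nat -> X).
Hypotheses (basis_e : schauder_basis e) (norm_e : normalized e).
Local Notation nrm := (nrm re).
Local Notation coef := (coef e).
Local Notation proj := (Defs.proj e).

(** The sets of indices that the greedy algorithm can select.  Greedy sums and
coordinate projections on such sets are the same vectors ([greedy_prefix] and
[greedy_ordering_of_set]), and sets are easier to cut and merge than orderings. *)
Definition greedy_set x (A : {fset nat}) :=
  forall i j, i \in A -> j \notin A -> nrm (coef x j) <= nrm (coef x i).

Lemma greedy_sum_perm x pi n (A : {fset nat}) : perm_eq A (mkseq pi n) ->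
  greedy_sum e x pi n = proj A x.
Proof.
move=> Api; rewrite /greedy_sum /Defs.proj (perm_big _ Api) /= big_map.
by rewrite -(big_mkord xpredT (fun k => coef x (pi k) *: e (pi k))) /index_iota subn0.
Qed.

Lemma greedy_ordering_chain x (D : nat -> {fset nat}) :
  (forall m, D m `<=` D m.+1)%fset -> (forall m, greedy_set x (D m)) ->
  exists2 pi, greedy_ordering e x pi & forall m, perm_eq (D m) (mkseq pi #|` D m|).
Proof.
move=> Dmono Dg.
have a_ge0 j : 0 <= nrm (coef x j) by exact: (nrm_ge0 S).
have a_cvg0 (eps : R) := @coef_cvs0 _ _ _ S _ _ basis_e norm_e x eps.
have [pi [pi_inj pi_mono pi_range pi_perm]] :=
  greedy_enumeration a_ge0 a_cvg0 Dmono Dg.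
exists pi => //; split => // [j /= jx|k].
  by have [|k <-] := pi_range j; [rewrite (nrm_eq0 S)|exists k].
by rewrite -!(emb_nrm S) (emb_le S).
Qed.

Lemma greedy_ordering_of_set x A : greedy_set x A ->
  exists2 pi, greedy_ordering e x pi & perm_eq A (mkseq pi #|` A|).
Proof.
move=> gA; have [//|//|pi gpi hpi] := @greedy_ordering_chain x (fun=> A).
by exists pi => //; exact: (hpi 0%N).
Qed.

Lemma greedy_ordering_le x pi k l : greedy_ordering e x pi -> (k <= l)%N ->
  nrm (coef x (pi l)) <= nrm (coef x (pi k)).
Proof.
move=> [_ _ mono] /subnKC <-; elim: (l - k)%N => [|n IH]; first by rewrite addn0.
by rewrite addnS; apply: le_trans IH; rewrite -(emb_le S) !(emb_nrm S).
Qed.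

Lemma greedy_prefix x pi n : greedy_ordering e x pi ->
  exists A, [/\ greedy_set x A, #|` A| = n & perm_eq A (mkseq pi n)].
Proof.
move=> gpi; have [pi_inj pi_range _] := gpi.
have u : uniq (mkseq pi n) by rewrite map_inj_uniq ?iota_uniq.
exists [fset j in mkseq pi n]%fset; split.
- move=> i j; rewrite !in_fset => /mapP[k]; rewrite mem_iota => /= kn -> jn.
  have [j0|/pi_range[l _ lj]] := eqVneq (coef x j) 0.
    by rewrite j0 (nrm0 S) (nrm_ge0 S).
  rewrite -lj; apply: greedy_ordering_le => //; apply: ltnW; apply: leq_trans kn _.
  rewrite leqNgt; apply: contra jn => ln; apply/mapP; exists l => //.
  by rewrite mem_iota.
- by rewrite card_fseq undup_id// size_mkseq.
- apply: uniq_perm; rewrite ?fset_uniq// => j; by rewrite in_fset.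
Qed.

End greedy_sets.

(** * Uniform boundedness of greedy projections *)

Section uniform_bound.
Context (R : realType) (K : numFieldType) (re : K -> R) (S : scalars re).
Context (X : completeNormedModType K) (e : nat -> X).
Hypotheses (basis_e : schauder_basis e) (norm_e : normalized e).
Hypothesis greedy_e : quasi_greedy e.
Local Notation emb := (emb S).
Local Notation nrm := (nrm re).
Local Notation coef := (coef e).
Local Notation proj := (Defs.proj e).
Local Notation partial_sum := (partial_sum e).
Local Notation greedy_set := (greedy_set re e).
Local Notation coefB := (coefB S basis_e).
Local Notation coefZ := (coefZ S basis_e).
Local Notation coef_partial_sum := (coef_partial_sum S basis_e).
Local Notation coef_proj := (coef_proj S basis_e).

Definition unbounded_greedy := forall M : R,
  exists x A, greedy_set x A /\ M * nrm x < nrm (proj A x).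

(** Unboundedness persists on late, finitely supported vectors: subtracting an
initial partial sum of [x] and truncating far out changes the norms of [x] and
of its greedy projection by amounts controlled by the basis constant, while
[A] minus the initial indices stays greedy. *)
Lemma hump (n : nat) (eps : R) : unbounded_greedy -> 0 < eps ->
  exists x A m, [/\ forall j, j \in A -> (n <= j < m)%N,
    forall j, ~~ (n <= j < m)%N -> coef x j = 0,
    greedy_set x A, 1 <= nrm (proj A x) & nrm x <= eps].
Proof.
move=> unb e0; have [kap [k1 psb cb]] := coef_bounded S basis_e norm_e.
have [x [A [gA]]] := unb (kap * (1 + kap) / eps + n%:R * (2 * kap)).
set c := kap * (1 + kap) => lx.
pose A' := [fset j in A | (n <= j)%N]%fset.
have [M hM] := fresh A; pose m := maxn n M.
pose y := partial_sum m (x - partial_sum n x).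
have cy j : coef y j = if (n <= j < m)%N then coef x j else 0.
  rewrite coef_partial_sum coefB coef_partial_sum andbC; case: ltnP => // _; case: ltnP => _ /=.
    by rewrite subrr.
  by rewrite subr0.
have inA' j : (j \in A') = (j \in A) && (n <= j)%N by rewrite !inE.
have A'm j : j \in A' -> (n <= j < m)%N.
  by rewrite inA' => /andP[/hM jM ->] /=; apply: leq_trans jM _; exact: leq_maxr.
have gy : greedy_set y A'.
  move=> i j iA jA; rewrite !cy (A'm i iA); case: ifP => [/andP[nj _]|_]; last first.
    by rewrite (nrm0 S) (nrm_ge0 S).
  move: jA iA; rewrite !inA' nj andbT => jA /andP[iA _]; exact: gA.
pose b j := if j \in A then coef x j else 0.
have pxy : proj A x - proj A' y = \sum_(j < n) b j *: e j.
  apply: (coef_inj S basis_e) => j; rewrite coefB !coef_proj cy (coef_ord_sum S basis_e) inA' /b.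
  have := A'm j; rewrite inA'; case: (j \in A) => /= [|_]; last by rewrite subr0 if_same.
  by case: (leqP n j) => /= [_ /(_ isT) ->|_ _]; rewrite (subrr, subr0).
have pd : nrm (proj A x - proj A' y) <= n%:R * (2 * kap) * nrm x.
  rewrite pxy; apply: le_trans (nrm_sum S _ _ _) _.
  apply: le_trans (ler_sum _ (G := fun=> 2 * kap * nrm x) _) _.
    move=> i _; rewrite (nrm_Ze S norm_e) /b; case: ifP => _ //.
    by rewrite (nrm0 S) !mulr_ge0 ?(nrm_ge0 S)//; lra.
  by rewrite sumr_const card_ord -mulr_natl; lra.
have ny : nrm y <= c * nrm x.
  apply: le_trans (psb _ _) _; rewrite /c -mulrA ler_wpM2l//; first by lra.
  apply: le_trans (nrm_triangleB S _ _) _; have := psb n x; lra.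
set q := nrm (proj A' y).
have qlt : c / eps * nrm x < q.
  have := nrm_triangle S (proj A x - proj A' y) (proj A' y).
  rewrite subrK -/q; move: lx pd; rewrite mulrDl; lra.
have q0 : 0 < q.
  apply: le_lt_trans qlt; rewrite mulr_ge0 ?(nrm_ge0 S)// divr_ge0 ?(ltW e0)//.
  by rewrite /c mulr_ge0//; lra.
exists (emb q^-1 *: y), A', m; split => //.
- by move=> j /negbTE jn; rewrite coefZ cy jn mulr0.
- move=> i j iA jA; rewrite !coefZ !(nrmM S); apply: ler_wpM2l; first exact: (nrm_ge0 S).
  exact: gy.
- rewrite (projZ S basis_e) (nrmZ S) (nrm_emb S) gtr0_norm ?invr_gt0// -/q.
  by rewrite mulVf ?gt_eqF.
- rewrite (nrmZ S) (nrm_emb S) gtr0_norm ?invr_gt0// mulrC ler_pdivrMr//.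
  by move: qlt ny; rewrite mulrAC ltr_pdivrMr//; lra.
Qed.

Lemma nonzero_lower_bound (a : nat -> R) m :
  exists2 d, 0 < d & forall i, (i < m)%N -> 0 < a i -> d <= a i.
Proof.
elim: m => [|m [d d0 IH]]; first by exists 1.
exists (if 0 < a m then Num.min d (a m) else d).
  by case: ifP => // am; rewrite lt_min d0.
move=> i; rewrite ltnS leq_eqVlt => /orP[/eqP -> am|im ai].
  by rewrite am ge_min lexx orbT.
by case: ifP => _; rewrite ?ge_min IH.
Qed.

(** The recursion step of the gliding hump.  The bound [eps'] for the next
vector is chosen so small that its coefficients, and those of all later
vectors, lie below the nonzero coefficients of [x]. *)
Lemma hump_step (n : nat) (eps : R) : unbounded_greedy -> 0 < eps ->
  exists x A m eps', [/\ forall j, j \in A -> (n <= j < m)%N,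
    forall j, ~~ (n <= j < m)%N -> coef x j = 0,
    greedy_set x A, 1 <= nrm (proj A x) & nrm x <= eps] /\
    [/\ 0 < eps', eps' <= eps / 2
      & forall i j y, coef x i != 0 -> nrm y <= eps' ->
          nrm (coef y j) <= nrm (coef x i)].
Proof.
move=> unb e0; have [x [A [m [h1 h2 h3 h4 h5]]]] := hump n unb e0.
have [kap [k1 _ cb]] := coef_bounded S basis_e norm_e.
have [d d0 hd] := nonzero_lower_bound (fun i => nrm (coef x i)) m.
exists x, A, m, (Num.min (eps / 2) (d / (2 * kap))); split => //.
have k20 : 0 < 2 * kap by lra.
split; first by rewrite lt_min !divr_gt0.
  by rewrite ge_min lexx.
move=> i j y xi; rewrite le_min => /andP[_]; rewrite ler_pdivlMr// => yd.
have im : (i < m)%N.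
  by rewrite ltnNge; apply: contra xi => mi; rewrite h2// negb_and -leqNgt mi orbT.
apply: le_trans (cb y j) _; apply: le_trans (hd i im _); first by rewrite mulrC.
by rewrite (nrm_gt0 S).
Qed.

(** Gliding hump.  If the greedy projections were unbounded, there would be
small vectors [xs k] on consecutive blocks of indices, with coefficients
decreasing from block to block, and greedy sets [A k] with
[proj (A k) (xs k)] of norm at least 1.  The initial blocks together with
[A k] are then greedy sets of [x], the sum of the [xs k], and one greedy
ordering runs through all of them.  The greedy sums of [x] over these sets
converge to [x], as do the partial sums over the initial blocks, but the two
differ by [proj (A k) (xs k)]. *)
Lemma greedy_projections_bounded : exists Q : R, 1 <= Q /\
  forall x A, greedy_set x A -> nrm (proj A x) <= Q * nrm x.
Proof.
suff [Q hQ] : exists Q : R, forall x A, greedy_set x A -> nrm (proj A x) <= Q * nrm x.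
  exists (Num.max Q 1); split => [|x A /hQ le]; first by rewrite le_max lexx orbT.
  by apply: le_trans le _; rewrite ler_wpM2r ?(nrm_ge0 S)// le_max lexx.
apply: contrapT => nbd.
have unb : unbounded_greedy.
  move=> M; apply: contrapT => H; apply: nbd; exists M => x A gA.
  by rewrite leNgt; apply/negP => lt; apply: H; exists x, A.
have step (s : nat * R) : exists q : X * {fset nat} * (nat * R), 0 < s.2 ->
    [/\ forall j, j \in q.1.2 -> (s.1 <= j < q.2.1)%N,
      forall j, ~~ (s.1 <= j < q.2.1)%N -> coef q.1.1 j = 0,
      greedy_set q.1.1 q.1.2, 1 <= nrm (proj q.1.2 q.1.1) & nrm q.1.1 <= s.2] /\
    [/\ 0 < q.2.2, q.2.2 <= s.2 / 2
      & forall i j y, coef q.1.1 i != 0 -> nrm y <= q.2.2 ->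
          nrm (coef y j) <= nrm (coef q.1.1 i)].
  case: s => n eps; have [e0|ne0] := boolP (0 < eps).
    by have [x [A [m [eps' h]]]] := hump_step n unb e0; exists (x, A, (m, eps')).
  by exists (0, fset0, (0%N, 0)).
have [f fP] := choice step.
pose fix st k := if k is l.+1 then (f (st l)).2 else (0%N, 1).
have st0 k : 0 < (st k).2.
  by elim: k => [|k IH] /=; [exact: ltr01|have [_ []] := fP _ IH].
pose n k := (st k).1; pose eps k := (st k).2.
pose xs k := (f (st k)).1.1; pose A k := (f (st k)).1.2.
have P k : [/\ forall j, j \in A k -> (n k <= j < n k.+1)%N,
      forall j, ~~ (n k <= j < n k.+1)%N -> coef (xs k) j = 0,
      greedy_set (xs k) (A k), 1 <= nrm (proj (A k) (xs k)) & nrm (xs k) <= eps k] /\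
    [/\ 0 < eps k.+1, eps k.+1 <= eps k / 2
      & forall i j y, coef (xs k) i != 0 -> nrm y <= eps k.+1 ->
          nrm (coef y j) <= nrm (coef (xs k) i)].
  exact: (fP (st k) (st0 k)).
have active k : exists2 j, j \in A k & coef (xs k) j != 0.
  apply: contrapT => H; have [[_ _ _ + _] _] := P k; apply/negP.
  suff -> : proj (A k) (xs k) = 0 by rewrite (nrm0 S) ler10.
  apply: (coef_inj S basis_e) => j; rewrite coef_proj (coef0 S basis_e).
  case: ifP => // jA; apply/eqP; apply: contrapT => /negP h; by apply: H; exists j.
have nS k : (n k < n k.+1)%N.
  have [j jA _] := active k; have [[/(_ _ jA)/andP[h1 h2] _ _ _ _] _] := P k.
  exact: leq_ltn_trans h2.
have nmono k l : (k <= l)%N -> (n k <= n l)%N.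
  move=> /subnKC <-; elim: (l - k)%N => [|p IH]; rewrite ?addn0// addnS.
  exact: leq_trans IH (ltnW (nS _)).
have nge k : (k <= n k)%N by elim: k => // k IH; exact: leq_ltn_trans (nS k).
have epsS k : eps k.+1 <= eps k / 2 by have [_ []] := P k.
have eps_pow k : eps k <= 2^-1 ^+ k.
  elim: k => [|k IH]; first by rewrite expr0 lexx.
  by have := epsS k; rewrite exprS; lra.
have eps_anti k l : (k <= l)%N -> eps l <= eps k.
  move=> /subnKC <-; elim: (l - k)%N => [|p IH]; rewrite ?addn0// addnS.
  by have := epsS (k + p)%N; have := st0 (k + p)%N; rewrite -/(eps _); lra.
have block j : exists k, (n k <= j < n k.+1)%N.
  have [k kj kmin] := ex_minnP (ex_intro (fun k => (j < n k)%N) j.+1 (nge j.+1)).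
  case: k kj kmin => [//|k] kj kmin; exists k; rewrite kj andbT leqNgt.
  by apply/negP => /kmin; rewrite ltnn.
pose W l := \sum_(k < l) xs k.
have Wtail k p : nrm (W (k + p)%N - W k) <= 2 * (2^-1 ^+ k - 2^-1 ^+ (k + p)).
  elim: p => [|p IH]; first by rewrite addn0 !subrr (nrm0 S) mulr0.
  rewrite addnS /W big_ord_recr /= -/(W (k + p)%N) addrAC.
  have := nrm_triangle S (W (k + p)%N - W k) (xs (k + p)%N).
  have [[_ _ _ _ le] _] := P (k + p)%N; have := eps_pow (k + p)%N.
  by rewrite (exprS _ (k + p)); move: le IH; lra.
have [x hx] : exists x, cvs re W x.
  apply: (cauchys_cvs S) => d d0; have [k hk] := ex_half_lt 2 d0.
  exists k => l /subnKC <-; apply: le_lt_trans (Wtail _ _) _.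
  by have : 0 <= 2^-1 ^+ (k + (l - k)) :> R by []; lra.
have [kap [k1 _ cb]] := coef_bounded S basis_e norm_e.
have coefW j : cvs re (fun l => coef (W l) j) (coef x j).
  move=> d d0; have k20 : 0 < 2 * kap by lra.
  have [l0 hl] := hx _ (divr_gt0 d0 k20); exists l0 => i /hl.
  rewrite ltr_pdivlMr// -coefB mulrC; apply: le_lt_trans; exact: cb.
have cx k j : (n k <= j < n k.+1)%N -> coef x j = coef (xs k) j.
  move=> /andP[kj jk].
  apply: (cvs_eventually_const S (n0 := k.+1) _ (coefW j)) => l kl.
  rewrite (coef_sum S basis_e) (bigD1 (Ordinal kl)) //= big1 ?addr0// => i.
  rewrite -val_eqE /= => ik; have [[_ h _ _ _] _] := P i; apply: h.
  rewrite negb_and -ltnNge -leqNgt; case: (ltngtP i k) ik => // [ik|ki] _.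
    by rewrite (leq_trans (nmono _ _ ik) kj) orbT.
  by rewrite (leq_trans jk (nmono _ _ ki)).
have cross i j k : (i < n k)%N -> (n k <= j)%N -> coef x i != 0 ->
    nrm (coef x j) <= nrm (coef x i).
  move=> ik kj; have [k' ik'] := block i; have [l jl] := block j.
  rewrite (cx _ _ ik') (cx _ _ jl) => xi.
  have [_ [_ _ h]] := P k'; apply: h => //.
  have [[_ _ _ _ le] _] := P l; apply: le_trans le _; apply: eps_anti.
  have k'k : (k' < k)%N.
    rewrite ltnNge; apply/negP => /nmono le; have /andP[h _] := ik'.
    by move: (leq_trans le h); rewrite leqNgt ik.
  have kl : (k <= l)%N.
    rewrite leqNgt; apply/negP => /nmono le; have /andP[_ h] := jl.
    by move: (leq_trans h le); rewrite ltnNge kj.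
  exact: leq_trans kl.
pose B k := [fset j in iota 0 (n k.+1) |
  (coef x j != 0) && ((j < n k)%N || (j \in A k))]%fset.
have inB k j : (j \in B k) =
    [&& (j < n k.+1)%N, coef x j != 0 & (j < n k)%N || (j \in A k)].
  by rewrite !inE mem_iota add0n.
have gB k : greedy_set x (B k).
  move=> i j; rewrite !inB => /and3P[ik xi iA].
  case: (ltnP j (n k.+1)) => /= [jk|kj _]; last exact: cross ik kj xi.
  rewrite negb_and negbK => /orP[/eqP ->|]; first by rewrite (nrm0 S) (nrm_ge0 S).
  rewrite negb_or -leqNgt => /andP[kj jA].
  have [ik'|ki] := ltnP i (n k); first exact: cross ik' kj xi.
  rewrite !(cx k) ?kj ?ki//; have [[_ _ gA _ _] _] := P k; apply: gA => //.
  by move: iA; rewrite ltnNge ki.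
have Bmono k : (B k `<=` B k.+1)%fset.
  apply/fsubsetP => j; rewrite !inB => /and3P[jk -> _].
  by rewrite jk (ltn_trans jk (nS _)).
have Bcard k : (k <= #|` B k|)%N.
  elim: k => // k IH; apply: leq_ltn_trans IH _; apply: fproper_ltn_card.
  rewrite fproperE Bmono; apply/fsubsetPn.
  have [j jA xj] := active k.+1; have [[/(_ _ jA) jn _ _ _ _] _] := P k.+1.
  exists j; first by rewrite inB (cx _ _ jn) xj jA orbT; case/andP: jn => _ ->.
  by rewrite inB ltnNge; case/andP: jn => ->.
have Bproj k : proj (B k) x - partial_sum (n k) x = proj (A k) (xs k).
  apply: (coef_inj S basis_e) => j; rewrite coefB !coef_proj coef_partial_sum inB.
  have [[/(_ j) Ak hz _ _ _] _] := P k.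
  have [jk|kj] /= := ltnP j (n k).
    rewrite (leq_trans jk (ltnW (nS k))) andbT /=.
    have -> : (j \in A k) = false.
      by apply/negP => /Ak /andP[h _]; move: jk; rewrite ltnNge h.
    by case: eqP => [->|_] /=; rewrite subrr.
  rewrite subr0; have [jk'|kj'] /= := ltnP j (n k.+1).
    rewrite (cx k) ?kj//; case: eqP => [->|_] //=; by case: ifP.
  by case: ifP => // /Ak /andP[_]; rewrite ltnNge kj'.
have [pi gpi hpi] := greedy_ordering_chain S basis_e norm_e Bmono gB.
have half0 : 0 < 2^-1 :> R by [].
have /(cvsP S)/(_ _ half0)[n0 h0] := greedy_e gpi.
have [n1 h1] := coef_expands S basis_e x half0.
have := h0 _ (leq_trans (leq_maxl n0 n1) (Bcard _)).
have := h1 _ (leq_trans (leq_maxr n0 n1) (nge _)).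
set k := maxn n0 n1; rewrite (greedy_sum_perm _ _ (hpi k)) -/(partial_sum (n k) x) => l1 l0.
have := nrm_triangleB S (proj (B k) x - x) (partial_sum (n k) x - x).
rewrite opprB addrA subrK Bproj; have [[_ _ _ + _] _] := P k.
by lra.
Qed.

End uniform_bound.

(** * Unconditionality for constant coefficients and truncation *)

Section estimates.
Context (R : realType) (K : numFieldType) (re : K -> R) (S : scalars re).
Context (X : completeNormedModType K) (e : nat -> X).
Hypotheses (basis_e : schauder_basis e) (norm_e : normalized e).
Local Notation emb := (emb S).
Local Notation nrm := (nrm re).
Local Notation coef := (coef e).
Local Notation proj := (Defs.proj e).
Local Notation greedy_set := (greedy_set re e).
Local Notation coef_fset_sum := (coef_fset_sum S basis_e).
Context (Q : R).
Hypotheses (Q_ge1 : 1 <= Q)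
  (proj_le : forall x A, greedy_set x A -> nrm (proj A x) <= Q * nrm x).

Lemma Q_ge0 : 0 <= Q.
Proof. exact: le_trans ler01 Q_ge1. Qed.

(** The sum is affine in each weight, so its norm is largest when every weight
is 0 or 1.  The offset [u] carries the terms already treated. *)
Lemma convex_subsums (s : seq nat) (v : nat -> X) (b : nat -> R) M u :
  (forall j, 0 <= b j <= 1) ->
  (forall s', subseq s' s -> nrm (u + \sum_(j <- s') v j) <= M) ->
  nrm (u + \sum_(j <- s) emb (b j) *: v j) <= M.
Proof.
move=> b01; elim: s u => [|h s IH] u sub.
  by have := sub [::] (sub0seq _); rewrite !big_nil.
rewrite big_cons; set T := \sum_(j <- s) _.
have le1 : nrm (u + T) <= M.
  by apply: IH => s' ss; apply: sub; apply: subseq_trans ss (subseq_cons _ _).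
have le2 : nrm (u + v h + T) <= M.
  apply: IH => s' ss; have := sub (h :: s').
  by rewrite /= eqxx big_cons addrA; apply.
have -> : u + (emb (b h) *: v h + T)
    = emb (1 - b h) *: (u + T) + emb (b h) *: (u + v h + T).
  rewrite rmorphB rmorph1 scalerBl scale1r (addrAC u (v h)) (scalerDr _ (u + T)).
  by rewrite subrKA addrA addrAC.
apply: le_trans (nrm_triangle S _ _) _; rewrite !(nrmZ S) !(nrm_emb S).
have /andP[b0 b1] := b01 h; rewrite !ger0_norm//; last by lra.
by have := nrm_ge0 S (u + T); have := nrm_ge0 S (u + v h + T); nra.
Qed.

(** A coefficient of modulus at most 1 is a combination of four numbers of
[0, 1], the positive and negative parts of its real and imaginary parts, and a
combination with weights in [0, 1] is a convex combination of subsums. *)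
Lemma bounded_weights (s : seq nat) (v : nat -> X) (b : nat -> K) M :
  (forall j, nrm (b j) <= 1) ->
  (forall s', subseq s' s -> nrm (\sum_(j <- s') v j) <= M) ->
  nrm (\sum_(j <- s) b j *: v j) <= 4 * M.
Proof.
move=> b1 sub.
have part (p : nat -> R) : (forall j, 0 <= p j <= 1) ->
    nrm (\sum_(j <- s) emb (p j) *: v j) <= M.
  move=> p01; rewrite -[\sum_(j <- s) _]add0r; apply: convex_subsums => // s' ss.
  by rewrite add0r; exact: sub.
pose pos (t : R) := Num.max t 0.
have pos01 t : `|t| <= 1 -> 0 <= pos t <= 1.
  rewrite ler_norml /pos => /andP[_ t1].
  by rewrite le_max lexx orbT ge_max t1 ler01.
have posE t : t = pos t - pos (- t).
  rewrite /pos; case: (leP t 0) => t0.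
    by rewrite max_l ?oppr_ge0// opprK add0r.
  by rewrite max_r ?subr0// oppr_le0 ltW.
have bE j : b j = emb (pos (re (b j))) - emb (pos (- re (b j)))
    + imu S * (emb (pos (im S (b j))) - emb (pos (- im S (b j)))).
  by rewrite -!rmorphB -!posE; exact: re_im.
have reb j : `|re (b j)| <= 1 by apply: le_trans (re_le S _) (b1 j).
have imb j : `|im S (b j)| <= 1 by apply: le_trans (im_le S _) (b1 j).
rewrite (eq_bigr (fun j => emb (pos (re (b j))) *: v j - emb (pos (- re (b j))) *: v j
    + imu S *: (emb (pos (im S (b j))) *: v j - emb (pos (- im S (b j))) *: v j)));
  last by move=> j _; rewrite {1}bE scalerDl -scalerA !scalerBl.
rewrite big_split -scaler_sumr !sumrB /=.
have i1 : nrm (imu S) <= 1.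
  by rewrite -(emb_le S) (emb_nrm S) rmorph1 imu_le1.
have p1 := part (fun j => pos (re (b j))) (fun j => pos01 _ (reb j)).
have p2 := part (fun j => pos (- re (b j))) _.
have p3 := part (fun j => pos (im S (b j))) (fun j => pos01 _ (imb j)).
have p4 := part (fun j => pos (- im S (b j))) _.
have {}p2 := p2 (fun j => pos01 _ (eq_ind_r (fun z => z <= 1) (reb j) (normrN _))).
have {}p4 := p4 (fun j => pos01 _ (eq_ind_r (fun z => z <= 1) (imb j) (normrN _))).
apply: le_trans (nrm_triangle S _ _) _; rewrite (nrmZ S).
have t1 := le_trans (nrm_triangleB S _ _) (lerD p1 p2).
have t2 := le_trans (nrm_triangleB S _ _) (lerD p3 p4).
have := nrm_ge0 S (imu S).
have := nrm_ge0 S (\sum_(i <- s) emb (pos (im S (b i))) *: v i -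
       \sum_(i <- s) emb (pos (- im S (b i))) *: v i).
nra.
Qed.

(** Every subset of [G] is a greedy set of a vector supported on [G] with
coefficients of constant modulus, so all subsums are controlled by the greedy
projections. *)
Lemma unimodular_unconditional (G : {fset nat}) (eta b : nat -> K) :
  (forall j, j \in G -> nrm (eta j) = 1) -> (forall j, nrm (b j) <= 1) ->
  nrm (\sum_(j <- G) b j *: (eta j *: e j)) <= 4 * Q * nrm (\sum_(j <- G) eta j *: e j).
Proof.
move=> eta1 b1; rewrite -mulrA; apply: bounded_weights => // s' ss.
have us : uniq s' by apply: subseq_uniq ss (fset_uniq _).
set v := \sum_(j <- G) _.
have subG j : j \in s' -> j \in G by exact: mem_subseq.
have -> : \sum_(j <- s') eta j *: e j = proj [fset j in s']%fset v.
  have pe : perm_eq s' [fset j in s']%fset.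
    by apply: uniq_perm; rewrite ?fset_uniq// => j; rewrite in_fset.
  rewrite (perm_big _ pe) /=.
  apply: eq_big_seq => j; rewrite in_fset => js.
  by rewrite coef_fset_sum subG.
apply: proj_le => i j; rewrite !in_fset => is' _.
rewrite !coef_fset_sum (subG i is') (eta1 i (subG i is')); case: ifP => [/eta1 ->//|_].
by rewrite (nrm0 S) ler01.
Qed.

Definition one_vec (A : {fset nat}) := \sum_(j <- A) e j.

Lemma one_vecE A : one_vec A = \sum_(j <- A) 1 *: e j.
Proof. by apply: eq_bigr => j _; rewrite scale1r. Qed.

Lemma coef_one_vec A j : coef (one_vec A) j = (j \in A)%:R.
Proof. by rewrite one_vecE coef_fset_sum; case: ifP. Qed.

(** [unimodular_unconditional] with all [eta j] equal to 1, scaled by [m]. *)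
Lemma bounded_coef_sum (A : {fset nat}) (b : nat -> K) (m : R) : 0 <= m ->
  (forall j, j \in A -> nrm (b j) <= m) ->
  nrm (\sum_(j <- A) b j *: e j) <= 4 * Q * m * nrm (one_vec A).
Proof.
rewrite le_eqVlt => /orP[/eqP <- b0|m0 bm].
  rewrite big1_seq ?(nrm0 S) ?mulr0 ?mul0r// => j /= jA.
  have /eqP : nrm (b j) = 0 by apply/eqP; rewrite eq_le b0// (nrm_ge0 S).
  by rewrite (nrm_eq0 S) => /eqP ->; rewrite scale0r.
pose c j := if j \in A then emb m^-1 * b j else 0.
have -> : \sum_(j <- A) b j *: e j = emb m *: \sum_(j <- A) c j *: (1 *: e j).
  rewrite scaler_sumr; apply: eq_big_seq => j jA.
  by rewrite /c jA scale1r scalerA mulrA -rmorphM mulfV ?gt_eqF// rmorph1 mul1r.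
rewrite (nrmZ S) (nrm_emb S) gtr0_norm// one_vecE mulrAC mulrC ler_pM2r//.
apply: unimodular_unconditional => [j _|j]; first exact: (nrm1 S).
rewrite /c; case: ifP => [jA|_]; last by rewrite (nrm0 S) ler01.
rewrite (nrmM S) (nrm_emb S) gtr0_norm ?invr_gt0// mulrC ler_pdivrMr// mul1r.
exact: bm.
Qed.

(** Summation by parts: the weighted sum differs from [w n] times the full sum
by a combination of partial sums with the increments of [w] as weights, and
these add up to at most [w n]. *)
Lemma abel_bound (v : nat -> X) (w : nat -> R) M n :
  (forall k, (k <= n.+1)%N -> nrm (\sum_(i < k) v i) <= M) ->
  (forall k, 0 <= w k) -> (forall k, (k < n)%N -> w k <= w k.+1) ->
  nrm (\sum_(i < n.+1) emb (w i) *: v i) <= 2 * w n * M.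
Proof.
move=> vM w0 wmono.
have aux k : (k <= n)%N -> nrm (\sum_(i < k.+1) emb (w i) *: v i
    - emb (w k) *: \sum_(i < k.+1) v i) <= w k * M.
  elim: k => [_|k IH kn].
    rewrite !big_ord1 subrr (nrm0 S) mulr_ge0//.
    by apply: le_trans (nrm_ge0 S _) (vM 0%N _).
  have := IH (ltnW kn); rewrite 2!(big_ord_recr k.+1) /=.
  set T := \sum_(i < k.+1) emb _ *: _; set V := \sum_(i < k.+1) v i => {}IH.
  have -> : T + emb (w k.+1) *: v k.+1 - emb (w k.+1) *: (V + v k.+1)
      = (T - emb (w k) *: V) - emb (w k.+1 - w k) *: V.
    by rewrite rmorphB scalerBl scalerDr opprB subrKA opprD addrACA subrr addr0.
  apply: le_trans (nrm_triangleB S _ _) _.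
  rewrite (nrmZ S) (nrm_emb S) ger0_norm ?subr_ge0 ?wmono//.
  have := vM k.+1 (leqW kn); rewrite -/V; have := wmono _ kn; nra.
have := aux _ (leqnn n); set T := \sum_(i < n.+1) emb _ *: _.
set V := \sum_(i < n.+1) v i => le.
have := nrm_triangle S (T - emb (w n) *: V) (emb (w n) *: V).
rewrite subrK (nrmZ S) (nrm_emb S) ger0_norm//.
have := vM _ (leqnn n.+1); rewrite -/V; have := w0 n; nra.
Qed.

(** Replacing the coefficients on a greedy set by their signs times a lower
bound [alpha] amounts to weights that increase to at most 1 along a greedy
ordering, so summation by parts reduces the bound to greedy sums. *)
Lemma truncation_bound z (G : {fset nat}) (alpha : R) : 0 < alpha -> greedy_set z G ->
  (forall j, j \in G -> alpha <= nrm (coef z j)) ->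
  nrm (\sum_(j <- G) emb (alpha / nrm (coef z j)) *: (coef z j *: e j)) <= 2 * Q * nrm z.
Proof.
move=> a0 gG aG.
have [pi gpi hpi] := greedy_ordering_of_set S basis_e norm_e gG.
rewrite (perm_big _ hpi) /= big_map -[#|` G|]subn0 -/(index_iota 0 _).
rewrite (big_mkord xpredT (fun k => emb (alpha / nrm (coef z (pi k))) *:
  (coef z (pi k) *: e (pi k)))).
have inG k : (k < #|` G|)%N -> pi k \in G.
  by move=> kG; rewrite (perm_mem hpi); apply/mapP; exists k; rewrite ?mem_iota.
case: #|` G| inG => [_|n inG].
  by rewrite big_ord0 (nrm0 S) !mulr_ge0 ?(nrm_ge0 S) ?Q_ge0.
pose w k := alpha / nrm (coef z (pi k)).
apply: le_trans (@abel_bound (fun k => coef z (pi k) *: e (pi k)) w (Q * nrm z) n _ _ _) _.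
- move=> k _; have [A [gA _ pA]] := greedy_prefix S k gpi.
  by have := greedy_sum_perm e z pA; rewrite /greedy_sum => ->; exact: proj_le.
- by move=> k; rewrite divr_ge0 ?(nrm_ge0 S)// ltW.
- move=> k kn; rewrite /w ler_pM2l// lef_pV2 ?posrE.
  + exact: (greedy_ordering_le S gpi).
  + by apply: lt_le_trans a0 (aG _ (inG _ _)); exact: ltnW.
  + by apply: lt_le_trans a0 (aG _ (inG _ _)).
have c0 : 0 < nrm (coef z (pi n)) by apply: lt_le_trans a0 (aG _ (inG _ _)).
have wn : w n <= 1 by rewrite /w ler_pdivrMr// mul1r; apply: aG; exact: inG.
by have := mulr_ge0 Q_ge0 (nrm_ge0 S z); nra.
Qed.

(** Coefficients of modulus at least [alpha] on an arbitrary finite set [B]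
already force a large norm.  All indices with such coefficients form a greedy
set [G], on which [truncation_bound] replaces the coefficients by [alpha] times
their signs [eta]; [unimodular_unconditional] then removes the signs and the
indices outside [B] at once. *)
Lemma one_vec_le z (B : {fset nat}) (alpha : R) : 0 < alpha ->
  (forall j, j \in B -> alpha <= nrm (coef z j)) ->
  alpha * nrm (one_vec B) <= 8 * Q ^+ 2 * nrm z.
Proof.
move=> a0 aB; have [n hn] := coef_cvs0 S basis_e norm_e z a0.
pose G := [fset j in iota 0 n | alpha <= nrm (coef z j)]%fset.
have inG j : (j \in G) = (alpha <= nrm (coef z j)).
  rewrite !inE mem_iota /= add0n; case: leP => //=; rewrite ?andbT ?andbF// => h.
  by rewrite ltnNge; apply/negP => /hn; rewrite ltNge h.
have gG : greedy_set z G.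
  by move=> i j; rewrite !inG -ltNge => ai /ltW ja; apply: le_trans ja ai.
have cG j : j \in G -> coef z j != 0.
  by rewrite inG -(nrm_gt0 S); exact: lt_le_trans.
pose eta j := (coef z j) / emb (nrm (coef z j)).
have eta1 j : j \in G -> nrm (eta j) = 1.
  move=> /cG jz; rewrite (nrmM S) (nrmV S) (nrm_emb S) ger0_norm ?(nrm_ge0 S)//.
  by rewrite mulfV// (nrm_eq0 S).
have aeta : emb alpha *: \sum_(j <- G) eta j *: e j =
    \sum_(j <- G) emb (alpha / nrm (coef z j)) *: (coef z j *: e j).
  rewrite scaler_sumr; apply: eq_bigr => j _.
  by rewrite !scalerA rmorphM fmorphV /eta mulrA mulrAC.
have aG j : j \in G -> alpha <= nrm (coef z j) by rewrite inG.
have le1 := truncation_bound a0 gG aG.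
pose b j := if j \in B then (eta j)^-1 else 0.
have BG j : j \in B -> j \in G by move=> /aB; rewrite inG.
have oneB : one_vec B = \sum_(j <- G) b j *: (eta j *: e j).
  apply: (coef_inj S basis_e) => j; rewrite coef_one_vec.
  rewrite (eq_bigr (fun j => (b j * eta j) *: e j)); last by move=> i _; rewrite scalerA.
  rewrite (coef_fset_sum G (fun j => b j * eta j)) /b.
  have [jB|jB] := boolP (j \in B); last by rewrite mul0r if_same.
  by rewrite BG// mulVf// -(nrm_eq0 S) eta1 ?BG// oner_eq0.
have b1 j : nrm (b j) <= 1.
  rewrite /b; case: ifP => [/BG /eta1 h|_]; last by rewrite (nrm0 S) ler01.
  by rewrite (nrmV S) h invr1.
have le2 := unimodular_unconditional eta1 b1.
rewrite -aeta (nrmZ S) (nrm_emb S) gtr0_norm// in le1.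
rewrite oneB; apply: le_trans (ler_wpM2l (ltW a0) le2) _.
set t := nrm (\sum_(j <- G) _) in le1 *.
have -> : alpha * (4 * Q * t) = 4 * Q * (alpha * t) by ring.
have -> : 8 * Q ^+ 2 * nrm z = 4 * Q * (2 * Q * nrm z) by ring.
by rewrite ler_wpM2l// mulr_ge0// Q_ge0.
Qed.

End estimates.

(** * Lebesgue-type inequalities between norms *)

Section lebesgue.
Context (R : realType) (K : numFieldType) (re : K -> R) (S : scalars re).
Context (X : completeNormedModType K) (e : nat -> X).
Hypotheses (basis_e : schauder_basis e) (norm_e : normalized e).
Local Notation emb := (emb S).
Local Notation nrm := (nrm re).
Local Notation coef := (coef e).
Local Notation proj := (Defs.proj e).
Local Notation partial_sum := (partial_sum e).
Local Notation greedy_set := (greedy_set re e).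
Local Notation one_vec := (one_vec e).
Local Notation coefB := (coefB S basis_e).
Local Notation coefD := (coefD S basis_e).
Local Notation coefZ := (coefZ S basis_e).
Local Notation coef_partial_sum := (coef_partial_sum S basis_e).
Local Notation coef_proj := (coef_proj S basis_e).
Local Notation coef_one_vec := (coef_one_vec S basis_e).
Local Notation coef_inj := (coef_inj S basis_e).
Context (Q : R).
Hypotheses (Q_ge1 : 1 <= Q)
  (proj_le : forall x A, greedy_set x A -> nrm (proj A x) <= Q * nrm x).

Definition democratic (T : R) N := forall A B : {fset nat}, #|` A| = #|` B| ->
  (1 <= #|` A| <= N)%N -> nrm (one_vec A) <= T * nrm (one_vec B).

Definition conditional (T : R) N := forall (A : {fset nat}) x, (#|` A| <= N)%N ->
  nrm (proj A x) <= T * nrm x.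

(** An upper bound [r] for the greedy constant, freed of orderings and suprema.
The set [F] of more than [N] nonzero coefficients is what keeps [x] at positive
distance from the vectors supported on [N] indices. *)
Definition greedy_within (r : R) N := forall x (G : {fset nat}), #|` G| = N -> greedy_set x G ->
  (exists F : {fset nat}, (N < #|` F|)%N /\ forall j, j \in F -> coef x j != 0) ->
  forall y (A : {fset nat}), (#|` A| <= N)%N -> (forall j, j \notin A -> coef y j = 0) ->
  nrm (x - proj G x) <= r * nrm (x - y).

Lemma fset_subset_card (A : {fset nat}) n : (n <= #|` A|)%N ->
  exists2 B : {fset nat}, (B `<=` A)%fset & #|` B| = n.
Proof.
move=> nA; exists [fset j in take n A]%fset.
  by apply/fsubsetP => j; rewrite in_fset => /mem_take.
by rewrite card_fseq undup_id ?take_uniq ?fset_uniq// size_take_min; apply/minn_idPl.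
Qed.

Lemma one_vec_gt0 (A : {fset nat}) : (1 <= #|` A|)%N -> 0 < nrm (one_vec A).
Proof.
move=> A1; rewrite (nrm_gt0 S); apply/eqP => A0.
have [j jA] : exists j, j \in A by apply/fset0Pn; rewrite -cardfs_gt0.
by have := coef_one_vec A j; rewrite A0 (coef0 S basis_e) jA => /esym/eqP; rewrite oner_eq0.
Qed.

Lemma one_vec1 j : nrm (one_vec [fset j]%fset) = 1.
Proof. by rewrite /one_vec big_seq_fset1 (nrm_e S norm_e). Qed.

Lemma democratic_ge1 T N : (1 <= N)%N -> democratic T N -> 1 <= T.
Proof.
move=> N1 /(_ [fset 0%N]%fset [fset 0%N]%fset erefl).
by rewrite cardfs1 N1 one_vec1 mulr1; apply.
Qed.

(** The remainder splits over [A `\` G] and its complement.  On [A `\` G] the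
coefficients of [x] are at most those on [G `\` A], where [x] and [z = x - y]
agree; this compares [proj (A `\` G) x] with [z] at the cost of the democracy
constant alone, since [one_vec_le] applies to [z] itself rather than to a
projection of it. *)
Lemma greedy_remainder_le T N x y (G A : {fset nat}) :
  1 <= T -> democratic T N -> conditional T N ->
  #|` G| = N -> greedy_set x G -> (#|` A| <= N)%N -> (forall j, j \notin A -> coef y j = 0) ->
  nrm (x - proj G x) <= (3 + 32 * Q ^+ 3) * T * nrm (x - y).
Proof.
move=> T1 dem con GN gG AN yA; set z := x - y.
have cz j : j \notin A -> coef z j = coef x j.
  by move=> /yA y0; rewrite coefB y0 subr0.
have -> : x - proj G x = (z - proj A z - proj (G `\` A)%fset z) + proj (A `\` G)%fset x.
  apply: coef_inj => j; rewrite (coefB x) coefD (coefB (z - _)) (coefB z) !coef_proj !in_fsetD.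
  have := cz j; case: (j \in A) => /= [_|->//].
    by case: (j \in G) => /=; rewrite !(subrr, subr0, addr0, add0r).
  by case: (j \in G) => /=; rewrite !(subrr, subr0, addr0, add0r).
have z0 := nrm_ge0 S z; have q0 := le_trans ler01 Q_ge1.
have part1 : nrm (z - proj A z - proj (G `\` A)%fset z) <= 3 * T * nrm z.
  have := nrm_triangleB S (z - proj A z) (proj (G `\` A)%fset z).
  have := nrm_triangleB S z (proj A z); have := con A z AN.
  have GAN : (#|` (G `\` A)%fset| <= N)%N.
    by rewrite -GN; apply: fsubset_leq_card; exact: fsubsetDl.
  have := con _ z GAN; nra.
suff part2 : nrm (proj (A `\` G)%fset x) <= 32 * Q ^+ 3 * T * nrm z.
  by apply: le_trans (nrm_triangle S _ _) _; lra.
have [->|/fset0Pn[j0 j0A]] := eqVneq (A `\` G)%fset fset0.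
  rewrite /Defs.proj big_seq_fset0 (nrm0 S) !mulr_ge0 ?exprn_ge0//; lra.
have c_ge0 j : 0 <= nrm (coef x j) by exact: (nrm_ge0 S).
have c_cvg0 (eps : R) := @coef_cvs0 _ _ _ S _ _ basis_e norm_e x eps.
have [|j1 [j1A jmax]] := c0_argmax c_ge0 c_cvg0 (P := fun j => j \in (A `\` G)%fset).
  by exists j0.
set alpha := nrm (coef x j1) in jmax.
have step1 : nrm (proj (A `\` G)%fset x) <= 4 * Q * alpha * nrm (one_vec (A `\` G)%fset).
  apply: (bounded_coef_sum S basis_e proj_le) => //; exact: (nrm_ge0 S).
have [a0|a0] := eqVneq alpha 0.
  apply: le_trans step1 _; rewrite a0 mulr0 mul0r !mulr_ge0 ?exprn_ge0//; lra.
have {}a0 : 0 < alpha by rewrite lt_def a0 (nrm_ge0 S).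
have cAG : (#|` (A `\` G)%fset| <= #|` (G `\` A)%fset|)%N.
  rewrite -(leq_add2l #|` (A `&` G)%fset|) cardfsID fsetIC cardfsID GN.
  exact: AN.
have [B BG cB] := fset_subset_card cAG.
have inB j : j \in B -> (j \in G) && (j \notin A).
  by move=> /(fsubsetP BG); rewrite in_fsetD andbC.
have step2 : alpha * nrm (one_vec B) <= 8 * Q ^+ 2 * nrm z.
  apply: (one_vec_le S basis_e norm_e Q_ge1 proj_le) => // j /inB/andP[jG jA].
  rewrite cz//; apply: gG => //.
  by move: j1A; rewrite in_fsetD => /andP[].
have step3 : nrm (one_vec (A `\` G)%fset) <= T * nrm (one_vec B).
  apply: dem; first by rewrite cB.
  rewrite cardfs_gt0; apply/andP; split; first by apply/fset0Pn; exists j0.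
  by apply: leq_trans AN; apply: fsubset_leq_card; exact: fsubsetDl.
(* Chain: P_(A - G) x, then one_vec (A - G), then one_vec B, then z. *)
apply: le_trans step1 _.
apply: le_trans (ler_wpM2l _ step3) _; first by rewrite !mulr_ge0// ltW.
have -> : 4 * Q * alpha * (T * nrm (one_vec B)) = 4 * Q * T * (alpha * nrm (one_vec B)).
  by ring.
have -> : 32 * Q ^+ 3 * T * nrm z = 4 * Q * T * (8 * Q ^+ 2 * nrm z) by ring.
by rewrite ler_wpM2l// !mulr_ge0//; lra.
Qed.

Lemma one_vecU (A B : {fset nat}) : [disjoint A & B]%fset ->
  one_vec (A `|` B)%fset = one_vec A + one_vec B.
Proof.
move=> dAB; apply: coef_inj => j; rewrite coefD !coef_one_vec in_fsetU.
have [jA|_] := boolP (j \in A); last by rewrite add0r.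
by rewrite (negbTE (fdisjointP dAB _ jA)) addr0.
Qed.

Definition segment M n : {fset nat} := [fset j in iota M n]%fset.

Lemma card_segment M n : #|` segment M n| = n.
Proof. by rewrite card_fseq undup_id ?iota_uniq// size_iota. Qed.

Lemma disjoint_segment (A : {fset nat}) M n : (forall j, j \in A -> (j < M)%N) ->
  [disjoint A & segment M n]%fset.
Proof.
move=> hM; apply/fdisjointP => j /hM jM.
by rewrite in_fset mem_iota negb_and -ltnNge jM.
Qed.

(** Pad with a set [E] of further indices, so that [B `|` E] is a greedy set of
[N] elements of the sum of the basis vectors over [A], [B] and [E]. *)
Lemma disjoint_democratic r N (A B : {fset nat}) : greedy_within r N -> 
  #|` A| = #|` B| -> (1 <= #|` A| <= N)%N -> [disjoint A & B]%fset ->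
  nrm (one_vec A) <= r * nrm (one_vec B).
Proof.
move=> H AB /andP[A1 AN] dAB.
have [M hM] := fresh (A `|` B)%fset.
pose E := segment M (N - #|` A|).
have dE := disjoint_segment (N - #|` A|) hM.
have dAE : [disjoint A & E]%fset.
  by apply: fdisjointWl dE; exact: fsubsetUl.
have dBE : [disjoint B & E]%fset.
  by apply: fdisjointWl dE; exact: fsubsetUr.
pose x := one_vec A + one_vec B + one_vec E.
have cx j : coef x j = (j \in (A `|` B `|` E)%fset)%:R.
  by rewrite /x -!one_vecU// coef_one_vec.
have pG : proj (B `|` E)%fset x = one_vec B + one_vec E.
  rewrite -one_vecU//; apply: coef_inj => j; rewrite coef_proj cx coef_one_vec !in_fsetU.
  by case: (j \in B); case: (j \in E); rewrite ?orbT //.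
have := H x (B `|` E)%fset _ _ _ (one_vec A + one_vec E) (A `|` E)%fset.
rewrite pG {1 2}/x.
have -> : one_vec A + one_vec B + one_vec E - (one_vec B + one_vec E) = one_vec A.
  by rewrite -(addrA (one_vec A) (one_vec B)) addrK.
have -> : one_vec A + one_vec B + one_vec E - (one_vec A + one_vec E) = one_vec B.
  by rewrite (addrC (one_vec A) (one_vec B)) -(addrA (one_vec B)) addrK.
apply.
- by rewrite cardfsU (eqP dBE) cardfs0 subn0 card_segment -AB subnKC.
- move=> i j iG _; rewrite !cx -fsetUA (in_fsetU A _ i) iG orbT (nrm1 S).
  by case: (_ \in _); rewrite ?(nrm1 S) ?(nrm0 S) ?ler01.
- exists (A `|` B `|` E)%fset; split; last by move=> j jF; rewrite cx jF oner_eq0.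
  rewrite cardfsU (eqP dE) cardfs0 subn0 card_segment cardfsU (eqP dAB) cardfs0 subn0.
  by rewrite -AB -addnA subnKC// -[X in (X < _)%N]add0n ltn_add2r.
- by rewrite cardfsU (eqP dAE) cardfs0 subn0 card_segment subnKC.
- by move=> j jn; rewrite -one_vecU// coef_one_vec (negbTE jn).
Qed.

Lemma greedy_within_ge1 r N : (1 <= N)%N -> greedy_within r N -> 1 <= r.
Proof.
move=> N1 H; have := @disjoint_democratic r N [fset 0%N]%fset [fset 1%N]%fset H.
rewrite !one_vec1 !cardfs1 N1 mulr1; apply => //.
by apply/fdisjointP => j; rewrite !inE => /eqP ->.
Qed.

Lemma one_vec_subset (A B : {fset nat}) : (A `<=` B)%fset ->
  nrm (one_vec A) <= Q * nrm (one_vec B).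
Proof.
move=> /fsubsetP AB.
have -> : one_vec A = proj A (one_vec B).
  apply: coef_inj => j; rewrite coef_proj !coef_one_vec.
  by case: ifP => // /AB ->.
apply: proj_le => i j /AB iB _; rewrite !coef_one_vec iB (nrm1 S).
by case: (_ \in _); rewrite ?(nrm1 S) ?(nrm0 S) ?ler01.
Qed.

(** Comparing [A] with [B] directly is only possible for disjoint sets; the
common part of [A] and [B] is a greedy set of the sum over [B], so it costs the
factor [Q] and not another factor [r]. *)
Lemma greedy_within_democratic r N : (1 <= N)%N -> greedy_within r N ->
  democratic (2 * Q * r) N.
Proof.
move=> N1 H A B AB /andP[A1 AN].
have r1 := greedy_within_ge1 N1 H.
have q1 := Q_ge1.
have -> : one_vec A = one_vec (A `&` B)%fset + one_vec (A `\` B)%fset.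
  rewrite -one_vecU ?fsetID//; apply/fdisjointP => j.
  by rewrite in_fsetI in_fsetD => /andP[_ ->].
have i1 := one_vec_subset (fsubsetIr A B).
have i2 := one_vec_subset (fsubsetDl B A).
have cD : #|` (A `\` B)%fset| = #|` (B `\` A)%fset|.
  apply/eqP; rewrite -(eqn_add2l #|` (A `&` B)%fset|) cardfsID fsetIC cardfsID.
  by rewrite AB.
have i3 : nrm (one_vec (A `\` B)%fset) <= r * nrm (one_vec (B `\` A)%fset).
  have [D0|Dn0] := eqVneq (A `\` B)%fset fset0.
    by rewrite D0 /one_vec big_seq_fset0 (nrm0 S) mulr_ge0 ?(nrm_ge0 S)//; lra.
  apply: (disjoint_democratic H) => //.
    rewrite cardfs_gt0 Dn0; apply: leq_trans AN; apply: fsubset_leq_card.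
    exact: fsubsetDl.
  by apply/fdisjointP => j; rewrite !in_fsetD => /andP[/negbTE -> ]; rewrite andbF.
apply: le_trans (nrm_triangle S _ _) _.
have := nrm_ge0 S (one_vec (B `\` A)%fset); have b0 := nrm_ge0 S (one_vec B).
have := ler_wpM2l (le_trans ler01 r1) i2.
have := ler_wpM2r (mulr_ge0 (le_trans ler01 q1) b0) r1.
by lra.
Qed.

(** Replacing the coefficients of [x] on [A] by a large constant makes [A] a
greedy set, whose remainder is [x - proj A x], without changing the distance to
the vectors supported on [A].  The finite support of [x] leaves room for the
padding set [E]. *)
Lemma finite_support_conditional r N (A : {fset nat}) m x : greedy_within r N ->
  0 <= r -> (#|` A| <= N)%N -> (forall j, (m <= j)%N -> coef x j = 0) ->
  nrm (x - proj A x) <= r * nrm x.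
Proof.
move=> H r0 AN xm.
have [x0|xn0] := eqVneq (x - proj A x) 0.
  by rewrite x0 (nrm0 S) mulr_ge0 ?(nrm_ge0 S).
have [j0 j0A xj0] : exists2 j, j \notin A & coef x j != 0.
  apply: contrapT => nex; move/eqP: xn0; apply; apply: coef_inj => j.
  rewrite coefB coef_proj (coef0 S basis_e); case: ifP => jA; first by rewrite subrr.
  rewrite subr0; apply/eqP; apply: contrapT => /negP xj; apply: nex.
  by exists j; rewrite ?jA.
have [M hM] := fresh A.
pose E := segment (maxn m M) (N - #|` A|).
have dAE : [disjoint A & E]%fset.
  by apply: disjoint_segment => j /hM jM; apply: leq_trans jM _; exact: leq_maxr.
have xE j : j \in E -> coef x j = 0.
  rewrite in_fset mem_iota => /andP[le _]; apply: xm; apply: leq_trans le.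
  exact: leq_maxl.
pose G := (A `|` E)%fset.
have cG : #|` G| = N.
  by rewrite cardfsU (eqP dAE) cardfs0 subn0 card_segment subnKC.
have [kap [k1 _ cb]] := coef_bounded S basis_e norm_e.
pose beta := 2 * kap * nrm x + 1.
have b0 : 0 < beta.
  have : 0 <= 2 * kap * nrm x by rewrite !mulr_ge0 ?(nrm_ge0 S)//; lra.
  by rewrite /beta; lra.
pose y := emb beta *: one_vec G - proj A x.
pose z := x + y.
have cy j : coef y j = (if j \in G then emb beta else 0) - (if j \in A then coef x j else 0).
  rewrite coefB coefZ coef_one_vec coef_proj; congr (_ - _).
  by case: (_ \in G); rewrite ?mulr1 ?mulr0.
have cz j : coef z j = if j \in G then emb beta else coef x j.
  rewrite coefD cy in_fsetU; case: (boolP (j \in A)) => [jA|jA] /=.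
    by rewrite addrCA subrr addr0.
  by rewrite subr0; case: ifP => [/xE ->|_]; rewrite ?add0r ?addr0.
have zx : z - y = x by rewrite /z addrK.
have -> : x - proj A x = z - proj G z.
  apply: coef_inj => j; rewrite !coefB !coef_proj cz in_fsetU.
  case: (boolP (j \in A)) => [jA|jA] /=; first by rewrite !subrr.
  by case: ifP => [/xE ->|_]; rewrite ?subrr ?subr0.
rewrite -zx; apply: (H z G cG _ _ y G) => //; last first.
- move=> j jG; rewrite cy (negbTE jG); move: jG; rewrite in_fsetU negb_or.
  by move=> /andP[/negbTE -> _]; rewrite subr0.
- by rewrite cG.
- exists (j0 |` G)%fset.
  have j0G : j0 \notin G.
    rewrite in_fsetU negb_or j0A; apply/negP => /xE h.
    by move: xj0; rewrite h eqxx.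
  split; first by rewrite cardfsU1 j0G cG.
  move=> j; rewrite in_fset1U cz => /orP[/eqP ->|->]; first by rewrite (negbTE j0G).
  by rewrite -(nrm_gt0 S) (nrm_emb S) gtr0_norm.
- move=> i j iG jG; rewrite !cz iG (negbTE jG) (nrm_emb S) gtr0_norm//.
  by have := cb x j; rewrite /beta; lra.
Qed.

(** Truncating [x] beyond [A] costs the basis constant and reduces the bound to
[finite_support_conditional]. *)
Lemma greedy_within_conditional : exists2 kap : R, 1 <= kap &
  forall r N, (1 <= N)%N -> greedy_within r N -> conditional (2 * kap * r) N.
Proof.
have [kap [k1 psb _]] := coef_bounded S basis_e norm_e.
exists kap => // r N N1 H A x AN.
have r1 := greedy_within_ge1 N1 H.
have [M hM] := fresh A.
have -> : proj A x = proj A (partial_sum M x).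
  apply: coef_inj => j; rewrite !coef_proj coef_partial_sum.
  by case: ifP => // /hM ->.
have le : nrm (partial_sum M x - proj A (partial_sum M x)) <= r * nrm (partial_sum M x).
  apply: (finite_support_conditional (m := M) H) => //; first by lra.
  by move=> j; rewrite coef_partial_sum ltnNge => ->.
have := nrm_triangleB S (partial_sum M x) (partial_sum M x - proj A (partial_sum M x)).
rewrite opprB addrC subrK; have := psb M x; have := nrm_ge0 S (partial_sum M x).
have := nrm_ge0 S x.
move=> x0 p0 pk tr.
apply: le_trans tr _; apply: le_trans (lerD (lexx _) le) _.
have : nrm (partial_sum M x) <= r * nrm (partial_sum M x) by rewrite ler_peMl.
have := ler_wpM2l (le_trans ler01 r1) pk; lra.
Qed.

End lebesgue.

(** * The greedy, democracy and conditionality constants *)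

Section constants.
Context (R : realType) (K : numFieldType) (re : K -> R) (S : scalars re).
Context (X : completeNormedModType K) (e : nat -> X).
Hypotheses (basis_e : schauder_basis e) (norm_e : normalized e).
Local Notation emb := (emb S).
Local Notation nrm := (nrm re).
Local Notation coef := (coef e).
Local Notation proj := (Defs.proj e).
Local Notation greedy_set := (greedy_set re e).
Local Notation one_vec := (one_vec e).
Local Notation sigma := (Defs.sigma re e).

Lemma SigmaP N y : Sigma e N y <->
  exists2 A : {fset nat}, (#|` A| <= N)%N & forall j, j \notin A -> coef y j = 0.
Proof.
split=> [yN|[A AN yA]].
  have fy := card_le_finite yN (finite_II N).
  exists (fset_set [set j | coef y j != 0]); first exact: geq_card_fset_set.
  by move=> j; rewrite in_fset_set// notin_setE /= => /negP; rewrite negbK => /eqP.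
rewrite /Sigma /=; apply: (@card_le_trans _ _ _ [set` A]).
  apply: subset_card_le => j /=; apply: contraNT => jA.
  exact/eqP/yA.
have /card_eq_fsetP := erefl #|` A|; rewrite card_eq_le => /andP[le _].
by apply: card_le_trans le _; rewrite card_le_II.
Qed.

Lemma sigma_le N x y : Sigma e N y -> (sigma N x <= (nrm (x - y))%:E)%E.
Proof. by move=> yN; apply: ereal_inf_lbound; exists y. Qed.

Lemma sigma_fin N x : exists2 s : R, 0 <= s & sigma N x = s%:E.
Proof.
have s0 : (0 <= sigma N x)%E.
  by apply/ereal_infP => _ [y _ <-]; rewrite lee_fin; exact: (nrm_ge0 S).
have sle : (sigma N x <= (nrm (x - 0))%:E)%E.
  apply: sigma_le; apply/SigmaP; exists fset0; first by rewrite cardfs0.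
  by move=> j _; rewrite (coef0 S basis_e).
by case: (sigma N x) s0 sle => // s; rewrite lee_fin => s0 _; exists s.
Qed.

(** A vector supported on [N] indices misses some index of [F], where the
bounded coefficient functional separates it from [x]. *)
Lemma sigma_neq0 N x (F : {fset nat}) : (N < #|` F|)%N ->
  (forall j, j \in F -> coef x j != 0) -> (sigma N x != 0)%E.
Proof.
move=> NF xF; have [kap [k1 _ cb]] := coef_bounded S basis_e norm_e.
have [M hM] := fresh F.
have [d d0 hd] := nonzero_lower_bound (fun i => nrm (coef x i)) M.
have k0 : 0 < 2 * kap by lra.
suff : ((d / (2 * kap))%:E <= sigma N x)%E.
  by move=> h; rewrite gt_eqF//; apply: lt_le_trans h; rewrite lte_fin divr_gt0.
apply/ereal_infP => _ [y /SigmaP[A AN yA] <-]; rewrite lee_fin ler_pdivrMr//.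
have [j jF jA] : exists2 j, j \in F & j \notin A.
  apply/fsubsetPn; apply/negP => /fsubset_leq_card le.
  by move: NF; rewrite ltnNge (leq_trans le AN).
apply: le_trans (hd j (hM _ jF) _) _; first by rewrite (nrm_gt0 S) xF.
have := cb (x - y) j; rewrite (coefB S basis_e) yA// subr0.
by move=> h; apply: le_trans h _; rewrite mulrC.
Qed.

Lemma ediv_le (a : \bar R) (s T : R) : 0 < s ->
  (a / s%:E <= T%:E)%E = (a <= (T * s)%:E)%E.
Proof. by move=> s0; rewrite inver gt_eqF// lee_pdivrMr// EFinM. Qed.

Lemma greedy_const_within r N :
  (greedy_const re e N <= r%:E)%E -> greedy_within re e r N.
Proof.
move=> le x G GN gG [F [NF xF]] y A AN yA.
have [pi gpi hpi] := greedy_ordering_of_set S basis_e norm_e gG.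
have snz := sigma_neq0 NF xF.
have yN : Sigma e N y by apply/SigmaP; exists A.
have := sigma_le x yN; have [s s0 sE] := sigma_fin N x.
have {}s0 : 0 < s by rewrite lt_def s0 andbT; move: snz; rewrite sE eqe.
have : (enorm re (x - greedy_sum e x pi N)%R / sigma N x <= r%:E)%E.
  by apply: le_trans le; apply: ereal_sup_ubound; exists x, pi.
rewrite sE ediv_le// lee_fin -GN (greedy_sum_perm e x hpi) lee_fin => h1 h2.
apply: le_trans (h1) _; rewrite ler_wpM2l//.
have := le_trans (nrm_ge0 S _) h1; rewrite pmulr_lge0//.
Qed.

Lemma greedy_const_le T N : 0 < T ->
  (forall x y (G A : {fset nat}), #|` G| = N -> greedy_set x G -> (#|` A| <= N)%N ->
    (forall j, j \notin A -> coef y j = 0) ->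
    nrm (x - proj G x) <= T * nrm (x - y)) ->
  (greedy_const re e N <= T%:E)%E.
Proof.
move=> T0 H; apply/ereal_supP => _ [x [pi [snz gpi ->]]].
have [s s0 sE] := sigma_fin N x.
have {}s0 : 0 < s by rewrite lt_def s0 andbT; move: snz; rewrite sE eqe.
have [G [gG GN hG]] := greedy_prefix S N gpi.
rewrite sE ediv_le// lee_fin (greedy_sum_perm e x hG) -ler_pdivrMl// -lee_fin -sE.
apply/ereal_infP => _ [y /SigmaP[A AN yA] <-].
by rewrite lee_fin ler_pdivrMl//; exact: (H x y G A).
Qed.

Lemma h_left_fin n : exists2 l : R, 0 <= l & h_left re e n = l%:E.
Proof.
have h0 : (0 <= h_left re e n)%E.
  by apply/ereal_infP => _ [A _ <-]; rewrite lee_fin; exact: (nrm_ge0 S).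
have hle : (h_left re e n <= (nrm (one_vec (segment 0 n)))%:E)%E.
  by apply: ereal_inf_lbound; exists (segment 0 n) => //; exact: card_segment.
by case: (h_left re e n) h0 hle => // l; rewrite lee_fin => l0 _; exists l.
Qed.

(** The bound itself shows that the left democracy function is positive, so the
quotients of extended reals are ordinary ones. *)
Lemma democracy_const_le T N : 0 < T ->
  democratic re e T N -> (democracy_const re e N <= T%:E)%E.
Proof.
move=> T0 dem; apply/ereal_supP => _ [n /= nN <-].
have [l l0 lE] := h_left_fin n.
have key (A : {fset nat}) : #|` A| = n -> nrm (one_vec A) <= T * l.
  move=> An; rewrite -ler_pdivrMl// -lee_fin -lE.
  apply/ereal_infP => _ [B /= Bn <-].
  by rewrite lee_fin ler_pdivrMl//; apply: dem; rewrite An.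
have {}l0 : 0 < l.
  have sn := card_segment 0 n.
  have s1 : (1 <= #|` segment 0 n|)%N by rewrite sn; case/andP: nN.
  have := lt_le_trans (one_vec_gt0 S basis_e s1) (key _ sn).
  by rewrite pmulr_rgt0.
rewrite lE ediv_le//; apply/ereal_supP => _ [A /= An <-].
by rewrite lee_fin; exact: key.
Qed.

Lemma le_democracy_const T N :
  (democracy_const re e N <= T%:E)%E -> democratic re e T N.
Proof.
move=> le A B AB AN; have [l l0 lE] := h_left_fin #|` A|.
have : (h_right re e #|` A| / h_left re e #|` A| <= T%:E)%E.
  by apply: le_trans le; apply: ereal_sup_ubound; exists #|` A|.
have hA : ((nrm (one_vec A))%:E <= h_right re e #|` A|)%E.
  by apply: ereal_sup_ubound; exists A.
have hB : (h_left re e #|` A| <= (nrm (one_vec B))%:E)%E.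
  by apply: ereal_inf_lbound; exists B.
have A0 : 0 < nrm (one_vec A) by apply: (one_vec_gt0 S basis_e); case/andP: AN.
rewrite lE in hB *; have [l00|ln0] := eqVneq l 0.
  rewrite l00 inve0 gt0_muley; first by [].
  by apply: lt_le_trans hA; rewrite lte_fin.
have {}l0 : 0 < l by rewrite lt_def ln0.
rewrite ediv_le// => h; have := le_trans hA h; rewrite lee_fin => h1.
apply: le_trans (h1) _; rewrite ler_wpM2l//.
by have := lt_le_trans A0 h1; rewrite pmulr_lgt0// => /ltW.
Qed.

Lemma cond_const_le T N : 0 <= T ->
  conditional re e T N -> (cond_const re e N <= T%:E)%E.
Proof.
move=> T0 con; apply/ereal_supP => _ [A /= AN <-].
apply/ereal_supP => _ [x /= x1 <-]; rewrite lee_fin.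
apply: le_trans (con A x AN) _; rewrite ler_piMr//.
by rewrite -(emb_le S) (emb_nrm S) rmorph1.
Qed.

Lemma le_cond_const T N : (cond_const re e N <= T%:E)%E -> conditional re e T N.
Proof.
move=> le A x AN; have [->|x0] := eqVneq x 0.
  rewrite (_ : proj A 0 = 0) ?(nrm0 S) ?mulr0//.
  by apply: big1 => j _; rewrite (coef0 S basis_e) scale0r.
have nx : 0 < nrm x by rewrite (nrm_gt0 S).
pose y := emb (nrm x)^-1 *: x.
have y1 : `|y| <= 1.
  rewrite -(emb_nrm S) -(rmorph1 emb) (emb_le S) (nrmZ S) (nrm_emb S).
  by rewrite gtr0_norm ?invr_gt0// mulVf ?gt_eqF.
have : ((nrm (proj A y))%:E <= T%:E)%E.
  apply: le_trans le; apply: le_trans (_ : _ <= op_norm re (proj A))%E _.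
    by apply: ereal_sup_ubound; exists y.
  by apply: ereal_sup_ubound; exists A.
rewrite lee_fin /y (projZ S basis_e) (nrmZ S) (nrm_emb S) gtr0_norm ?invr_gt0//.
by rewrite mulrC ler_pdivrMr.
Qed.

(** Each side is compared with the other through the real numbers that bound
it, which covers infinite values as well; the value [-oo] is excluded because
every bound is at least 1. *)
Lemma greedy_const_equiv : quasi_greedy e ->
  exists c c' : R, [/\ 0 < c, 0 < c' & forall N : nat, (1 <= N)%N ->
    (c%:E * maxe (democracy_const re e N) (cond_const re e N)
       <= greedy_const re e N
       <= c'%:E * maxe (democracy_const re e N) (cond_const re e N))%E].
Proof.
move=> greedy_e.
have [Q [Q1 proj_le]] := greedy_projections_bounded S basis_e norm_e greedy_e.
have [kap k1 con] := greedy_within_conditional S basis_e norm_e.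
pose C := 2 * Q + 2 * kap; pose c' := 3 + 32 * Q ^+ 3.
have C0 : 0 < C by rewrite /C; lra.
have c'0 : 0 < c'.
  by have : 0 <= Q ^+ 3 by [apply: exprn_ge0; lra]; rewrite /c'; lra.
exists C^-1, c'; split => // [|N N1]; first by rewrite invr_gt0.
apply/andP; split.
  have within r : (greedy_const re e N <= r%:E)%E ->
      1 <= r /\ (maxe (democracy_const re e N) (cond_const re e N) <= (C * r)%:E)%E.
    move=> /greedy_const_within H.
    have r1 := greedy_within_ge1 S basis_e norm_e N1 H; split=> //.
    have d1 := greedy_within_democratic S basis_e norm_e Q1 proj_le N1 H.
    have d2 := con _ _ N1 H.
    rewrite ge_max; apply/andP; split.
      apply: le_trans (democracy_const_le _ d1) _; first by rewrite !mulr_gt0//; lra.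
      by rewrite lee_fin /C; nra.
    apply: le_trans (cond_const_le _ d2) _; first by rewrite !mulr_ge0//; lra.
    by rewrite lee_fin /C; nra.
  case: (greedy_const re e N) within => [r|//|] within.
  - have [_] := within r (lexx _).
    by rewrite lee_pdivrMl// -EFinM.
  - by rewrite leey.
  - by have [] := within 0 (leNye _); rewrite ler10.
set M := maxe _ _.
have bound T : (M <= T%:E)%E -> 1 <= T /\ (greedy_const re e N <= (c' * T)%:E)%E.
  rewrite ge_max => /andP[/le_democracy_const dem /le_cond_const cnd].
  have T1 := democratic_ge1 S norm_e N1 dem; split=> //.
  apply: greedy_const_le => [|x y G A GN gG AN yA]; first by rewrite mulr_gt0//; lra.
  exact: (greedy_remainder_le S basis_e norm_e Q1 proj_le T1 dem cnd GN gG AN yA).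
case: M bound => [T||] bound.
- by have [_] := bound T (lexx _); rewrite -EFinM.
- by rewrite gt0_muley ?leey// lte_fin.
- by have [] := bound 0 (leNye _); rewrite ler10.
Qed.

End constants.

Lemma real_scalars (R : realType) : scalars (fun z : R => z).
Proof.
apply: (@Scalars R R (fun z => z) idfun (fun=> 0) 0) => //.
- by move=> a b; rewrite subrr.
- by move=> a; rewrite mul0r addr0.
- by move=> a; rewrite normr0.
- by rewrite normr0.
Qed.

Lemma complex_scalars (R : realType) : scalars (@complex.Re R).
Proof.
apply: (@Scalars R R[i] (@complex.Re R) (real_complex R) (@complex.Im R) (Complex 0 1)).
- by [].
- by move=> a; exact: RRe_real.
- by move=> r; rewrite ler0c.
- by case=> ? ? [? ?].
- by case=> ? ? [? ?].
- by move=> a; exact: complexE.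
- by move=> a; have := normc_ge_Re a; rewrite lecE => /andP[].
- move=> a; have := normc_ge_Re (a * Complex 0 1); rewrite ReiNIm normrN normrM.
  have -> : `|Complex 0 1 : R[i]| = 1.
    by rewrite normc_def /= expr0n /= add0r expr1n sqrtr1.
  by rewrite mulr1 lecE => /andP[].
- by rewrite normc_def /= expr0n /= add0r expr1n sqrtr1.
Qed.

Theorem theorem1p1 (R : realType) :
  (forall (X : completeNormedModType R) (e : nat -> X),
     schauder_basis e -> normalized e -> quasi_greedy e ->
     exists c c' : R, [/\ 0 < c, 0 < c' & forall N : nat, (1 <= N)%N ->
       (c%:E * maxe (democracy_const (fun z : R => z) e N)
                    (cond_const (fun z : R => z) e N)
          <= greedy_const (fun z : R => z) e N
          <= c'%:E * maxe (democracy_const (fun z : R => z) e N)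
                          (cond_const (fun z : R => z) e N))%E])
  /\
  (forall (X : completeNormedModType R[i]) (e : nat -> X),
     schauder_basis e -> normalized e -> quasi_greedy e ->
     exists c c' : R, [/\ 0 < c, 0 < c' & forall N : nat, (1 <= N)%N ->
       (c%:E * maxe (democracy_const (@complex.Re R) e N)
                    (cond_const (@complex.Re R) e N)
          <= greedy_const (@complex.Re R) e N
          <= c'%:E * maxe (democracy_const (@complex.Re R) e N)
                          (cond_const (@complex.Re R) e N))%E]).
Proof.
split=> X e basis_e norm_e greedy_e.
  exact: (greedy_const_equiv (real_scalars R) basis_e norm_e greedy_e).
exact: (greedy_const_equiv (complex_scalars R) basis_e norm_e greedy_e).
Qed.
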